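(* Let $\mathcal{H}$ be a separable Hilbert space, let $\mathcal{A}$ be a deterministic (unbounded) operator on $\mathcal{H}$, and let $\mathcal{S}$ be a deterministic and bounded operator. Given a stochastic partial differential equation of the form $$dX(t) = \mathcal{A} X(t)\,dt + \mathcal{S}\, dW(t),$$ where $W$ is a cylindrical Wiener process in $\mathcal{H}$, the first two moments of $X$ can be computed by $$\dot{m}(t) = \mathcal{A}\, m(t)$$ and $$\dot{\mathcal{P}}(t) = \mathcal{A}\,\mathcal{P}(t) + \mathcal{P}(t)\,\mathcal{A}^\star + \mathcal{S}\mathcal{S}^\star ,$$ where $m$ is the mean and $\mathcal{P}$ the covariance of the process $X$.
   Context: $\mathcal{A}$ is the infinitesimal generator of a semigroup $T(\cdot)$ with $T(t)\in L(\mathcal{H})$ for all $t\in[0,T]$. $\langle\cdot,\cdot\rangle$ is the inner product of $\mathcal{H}$ and $^\star$ denotes the adjoint. The mean is $m(t)=\mathbb{E}[X(t)]$. The covariance $\mathcal{P}(t)$ is defined, without centering, by $$\langle \mathcal{P}(t)\varphi,\psi\rangle := \mathbb{E}\big(\langle X(t),\varphi\rangle\,\langle X(t),\psi\rangle\big)\qquad\text{for all }\varphi,\psi\in\mathcal{H}.$$ *)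

(* Defs.v *)
From mathcomp Require Import all_boot all_order all_algebra.
From mathcomp Require Import all_classical all_reals all_analysis.
Set Implicit Arguments.
Unset Strict Implicit.
Unset Printing Implicit Defensive.
Import Order.TTheory GRing.Theory Num.Theory.
Import numFieldNormedType.Exports.
Local Open Scope classical_set_scope.
Local Open Scope ring_scope.

Definition separable (T : topologicalType) :=
  exists2 D : set T, countable D & dense D.

(* A (real) Hilbert space is a complete normed space whose norm comes from an
   inner product. *)
Definition induces_norm (R : realType) (H : completeNormedModType R)
    (ip : {dot H for idfun}) :=
  forall x : H, ip x x = `|x| ^+ 2.

(* [f] has derivative [l] at [t] along [D]; at an end point of an interval [D]
   this is the one-sided derivative. *)
Definition has_derivative_within (R : realType) (D : set R) (f : R -> R)
    (t l : R) :=
  (fun s => (f s - f t) / (s - t)) @ within D t^' --> l.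

(* Only the values on [dom] are meaningful. *)
Record operator (R : realType) (H : completeNormedModType R) :=
  Operator { dom : set H ; opfun :> H -> H }.

Section Operators.
Context {R : realType} {H : completeNormedModType R} (ip : {dot H for idfun}).
Implicit Types (A : operator H) (U : R -> H -> H).

Definition total_op (B : H -> H) : operator H := Operator setT B.

Definition adjoint_pair A (phi eta : H) :=
  forall x, dom A x -> ip (A x) phi = ip x eta.

(* When [dom A] is dense, [eta] is determined by [phi]. *)
Definition adjoint A : operator H :=
  Operator [set phi | exists eta, adjoint_pair A phi eta]
           (fun phi => xget 0 [set eta | adjoint_pair A phi eta]).

(* [U t] is meaningful for [0 <= t] only. *)
Record C0_semigroup U : Prop := {
  C0_linear : forall t, 0 <= t -> linear (U t) ;
  C0_bounded : forall t, 0 <= t -> continuous (U t) ;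
  C0_id : forall x, U 0 x = x ;
  C0_add : forall s t, 0 <= s -> 0 <= t -> forall x, U (s + t) x = U s (U t x) ;
  C0_continuous : forall x, U t x @[t --> 0^'+] --> x }.

Definition is_generator U A :=
  forall x y, (dom A x /\ A x = y) <->
    (h^-1 *: (U h x - x) @[h --> 0^'+] --> y).

End Operators.

Section Processes.
Context {R : realType} {H : completeNormedModType R} (ip : {dot H for idfun}).
Context {d : measure_display} {Omega : measurableType d}.
Variables (P : probability Omega R) (T : R).

Record filtration (F : R -> set (set Omega)) : Prop := {
  filtration_sigma : forall t, t \in `[0, T] -> sigma_algebra setT (F t) ;
  filtration_sub : forall t, t \in `[0, T] -> F t `<=` measurable ;
  filtration_mono : forall s t, s \in `[0, T] -> t \in `[0, T] -> s <= t ->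
    F s `<=` F t }.

Definition independent_of (G : set (set Omega)) (Y : Omega -> R) :=
  forall (A : set Omega) (B : set R), G A -> measurable B ->
    P (A `&` Y @^-1` B) = (P A * P (Y @^-1` B))%E.

Definition has_law (Y : Omega -> R) (mu : set R -> \bar R) :=
  forall B : set R, measurable B -> P (Y @^-1` B) = mu B.

Record brownian_motion (F : R -> set (set Omega)) (b : R -> Omega -> R)
    : Prop := {
  brownian_adapted : forall t, t \in `[0, T] ->
    forall B : set R, measurable B -> F t (b t @^-1` B) ;
  brownian_zero : {ae P, forall w, b 0 w = 0} ;
  brownian_law : forall s t, 0 <= s -> s < t -> t <= T ->
    has_law (b t \- b s) (normal_prob 0 (Num.sqrt (t - s))) ;
  brownian_indep : forall s t, 0 <= s -> s < t -> t <= T ->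
    independent_of (F s) (b t \- b s) ;
  brownian_continuous :
    {ae P, forall w, {within `[0, T], continuous (b ^~ w)}} }.

(* [W t h] stands for the formal pairing of the cylindrical process with [h];
   polarization gives E (W t h * W s k) = min t s * ip h k. *)
Record cylindrical_wiener (F : R -> set (set Omega)) (W : R -> H -> Omega -> R)
    : Prop := {
  wiener_linear : forall t, t \in `[0, T] -> forall (a : R) (h k : H),
    {ae P, forall w, W t (a *: h + k) w = a * W t h w + W t k w} ;
  wiener_brownian : forall h : H, `|h| = 1 -> brownian_motion F (W ^~ h) }.

(* Square-integrable weak solutions of dX = A X dt + S dW on [0, T], i.e. of
   d<X, phi> = <X, A^* phi> dt + dW(S^* phi) for all phi in dom A^*.  H carries
   its Borel sigma-algebra.  By joint measurability and the moment bound, almost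
   every path is integrable on [0, T]. *)
Record weak_solution (F : R -> set (set Omega)) (W : R -> H -> Omega -> R)
    (A : operator H) (S : H -> H) (X : R -> Omega -> H) : Prop := {
  solution_measurable : @measurable_fun _ _ (R * Omega)%type
    (g_sigma_algebraType (@open H)) (`[0, T] `*` setT) (fun p => X p.1 p.2) ;
  solution_adapted : forall t, t \in `[0, T] ->
    forall B, <<s @open H >> B -> F t (X t @^-1` B) ;
  solution_moments : exists M : R, forall t, t \in `[0, T] ->
    (\int[P]_w (`|X t w| ^+ 2)%:E <= M%:E)%E ;
  solution_equation : forall phi, dom (adjoint ip A) phi ->
    forall t, t \in `[0, T] ->
    {ae P, forall w, ip (X t w) phi = ip (X 0 w) phi
       + \int[lebesgue_measure]_(s in `[0, t]) ip (X s w) (adjoint ip A phi)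
       + W t (adjoint ip (total_op S) phi) w} }.

(* The expectation of an H-valued variable, tested against vectors. *)
Definition is_mean (X : R -> Omega -> H) (m : R -> H) :=
  forall t, t \in `[0, T] -> forall phi : H,
    ((ip (m t) phi)%:E = 'E_P[fun w => ip (X t w) phi])%E.

(* No centering. *)
Definition is_covariance (X : R -> Omega -> H) (C : R -> H -> H) :=
  forall t, t \in `[0, T] -> forall phi psi : H,
    ((ip (C t phi) psi)%:E
     = 'E_P[fun w => (ip (X t w) phi * ip (X t w) psi)%R])%E.

End Processes.

(* Main.v *)
Require Import Defs.
From HB Require Import structures.
From mathcomp Require Import all_boot all_order all_algebra.
From mathcomp Require Import all_classical all_reals all_analysis.
From mathcomp Require Import measurable_realfun ring lra.
Set Implicit Arguments.
Unset Strict Implicit.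
Unset Printing Implicit Defensive.
Import Order.TTheory GRing.Theory Num.Theory.
Import numFieldNormedType.Exports.
Local Open Scope classical_set_scope.
Local Open Scope ring_scope.

(* No Ito formula is needed.  For [phi] in [dom A^*] put [x t = <X t, phi>],
   [a t = <X t, A^* phi>] and [be t = W t (S^* phi)]: the weak equation reads
   [x t - x s = int_s^t a du + (be t - be s)].  The functions [x] are L^2(P)
   continuous for [phi] in [dom A^*], hence, by density of [dom A^*] and the
   uniform bound on the second moments, for every [phi].  Therefore [a] is L^2(P)
   continuous, and [x t - x s = (t - s) a tau + (be t - be s) + o(t - s)] in
   L^2(P) near [tau].  Multiplying two such expansions, and using that the noise
   increments are orthogonal to the past and have covariance [(t - s) <h, k>],
   gives the derivative of [E (x y)]; the derivative of the mean is the case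
   [y = 1].  The domain of [A^*] is dense because it contains the vectors
   [int_0^h U(s)^* phi ds], defined by Riesz representation. *)

(** * Hilbert spaces *)

(** The obstacle is that [A] is unbounded: for [phi] in the domain of [A^*] the vector [A^* phi] may
    lie outside that domain, so the weak equation says nothing direct about the drift [a]. The
    second moments break the circle. With the size of the noise they give continuity of [x] for
    [phi] in the domain, and, being bounded uniformly in time by a multiple of [|phi|], they let
    density carry continuity over to the coordinate along [A^* phi]. Noise increments have norm of
    order [sqrt (t - s)]: the product of two of them is of first order and leaves the term in
    [S S^*], whereas a noise increment times a drift or a remainder is negligible. Orthogonality to
    the past concerns the value at [s], while the drift is frozen at [tau]; since [tau] is [s] or
    [t], moving from one to the other costs a factor that tends to 0. In the density argument the
    adjoint semigroup is not known to be strongly continuous. Pairing with a vector before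
    integrating in time keeps every integral scalar. *)

Section InnerProduct.
Context {R : realType} {H : completeNormedModType R} (ip : {dot H for idfun}).
Hypothesis hip : induces_norm ip.
Implicit Types (x y z : H).

Lemma ipC x y : ip x y = ip y x.
Proof. by rewrite (hermC ip) expr0 mul1r. Qed.

Lemma ipDl x y z : ip (x + y) z = ip x z + ip y z.
Proof. exact: linearDl. Qed.

Lemma ipBl x y z : ip (x - y) z = ip x z - ip y z.
Proof. exact: linearBl. Qed.

Lemma ipZl a x z : ip (a *: x) z = a * ip x z.
Proof. exact: linearZl_LR. Qed.

Lemma ip0l z : ip 0 z = 0.
Proof. exact: linear0l. Qed.

Lemma ipDr x y z : ip x (y + z) = ip x y + ip x z.
Proof. by rewrite !(ipC x) ipDl. Qed.

Lemma ipBr x y z : ip x (y - z) = ip x y - ip x z.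
Proof. by rewrite !(ipC x) ipBl. Qed.

Lemma ipZr a x z : ip x (a *: z) = a * ip x z.
Proof. by rewrite !(ipC x) ipZl. Qed.

(** Cauchy-Schwarz: the quadratic [|x - a y|^2] in [a] is nonnegative, in particular at its
    minimizer [a = ip x y / |y|^2]. *)
Lemma ip_le_norm x y : `|ip x y| <= `|x| * `|y|.
Proof.
have key a : 0 <= `|x| ^+ 2 - 2 * a * ip x y + a ^+ 2 * `|y| ^+ 2.
  have : 0 <= ip (x - a *: y) (x - a *: y) by rewrite hip sqr_ge0.
  by rewrite !(ipBl, ipBr, ipZl, ipZr) !hip (ipC y x) => h; lra.
have [y0|y0] := eqVneq `|y| 0.
  have := key (`|x| ^+ 2 + 1); have := key (- (`|x| ^+ 2 + 1)).
  rewrite y0; set c := ip x y; set n := `|x| ^+ 2 => h1 h2.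
  suff -> : c = 0 by rewrite normr0 mulr0.
  (* When [|y| = 0] the quadratic degenerates to [n - 2 a c]; for nonzero [c] this value of [a]
     makes it [-1]. *)
  pose b := (n + 1) / (2 * c).
  have [//|c0] := eqVneq c 0.
  have := key b; rewrite -/c -/n y0 /b.
  have -> : 2 * ((n + 1) / (2 * c)) * c = n + 1 by field.
  by move=> h; lra.
have y2 : 0 < `|y| ^+ 2 by rewrite exprn_gt0// lt_def y0 normr_ge0.
rewrite -ler_sqr ?nnegrE ?mulr_ge0// real_normK ?num_real// exprMn.
have := key (ip x y / `|y| ^+ 2).
set c := ip x y; set n := `|y| ^+ 2 in y2 *; set m := `|x| ^+ 2.
have -> : m - 2 * (c / n) * c + (c / n) ^+ 2 * n = (m * n - c ^+ 2) / n.
  by field; rewrite gt_eqF.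
by rewrite pmulr_lge0 ?invr_gt0// subr_ge0.
Qed.

Lemma continuous_ipl y : continuous (fun x => ip x y).
Proof.
move=> x; apply/(@cvgrPdist_le _ _ _ (nbhs x)) => e e0.
have d0 : 0 < e / (`|y| + 1) by rewrite divr_gt0// ltr_wpDl.
near=> z; rewrite -ipBl (le_trans (ip_le_norm _ _))//.
have : `|x - z| <= e / (`|y| + 1) by near: z; exact: cvgr_dist_le.
move=> /(ler_wpM2r (normr_ge0 y))/le_trans; apply.
by rewrite mulrAC ler_pdivrMr ?ltr_wpDl// ler_wpM2l ?(ltW e0)// lerDl.
Unshelve. all: by end_near. Qed.

Lemma parallelogram x y :
  `|x + y| ^+ 2 + `|x - y| ^+ 2 = 2 * `|x| ^+ 2 + 2 * `|y| ^+ 2.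
Proof. by rewrite -!hip !(ipBl, ipBr, ipDl, ipDr); ring. Qed.

Definition linear_subspace (V : set H) :=
  V 0 /\ forall a x y, V x -> V y -> V (a *: x + y).

Lemma linear_subspace_closure (V : set H) : linear_subspace V -> linear_subspace (closure V).
Proof.
move=> [V0 VL]; split; first exact: subset_closure.
move=> a x y /= Vx Vy B /nbhs_normP[e /= e0 eB].
have [u [Vu xu]] := Vx _ (nbhsx_ballx x (e / (2 * (`|a| + 1)))
  ltac:(by rewrite divr_gt0// mulr_gt0// ltr_wpDl)).
have [v [Vv yv]] := Vy _ (nbhsx_ballx y (e / 2) ltac:(by rewrite divr_gt0)).
exists (a *: u + v); split; first exact: VL.
apply: eB => /=; rewrite opprD addrACA -scalerBr.
move: xu yv; rewrite -!ball_normE/= => xu yv.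
rewrite (le_lt_trans (ler_normD _ _))// normrZ (splitr e) ler_ltD//.
have : `|a| * `|x - u| <= (`|a| + 1) * (e / (2 * (`|a| + 1))).
  by rewrite ler_pM// ?lerDl// ltW.
move=> /le_trans; apply; rewrite le_eqVlt; apply/orP; left; apply/eqP.
by field; rewrite gt_eqF// ltr_wpDl.
Qed.

(** The vector is [x0 - w], where [x0] is outside [V] and [w] is the point of [V] nearest to [x0].
    Completeness provides [w] as the limit of a minimizing sequence, and minimality forces
    orthogonality. *)
Lemma exists_orthogonal (V : set H) : linear_subspace V -> closed V -> V != setT ->
  exists2 z, z != 0 & forall v, V v -> ip v z = 0.
Proof.
move=> [V0 VL] Vc /setTPn[x0 x0V].
pose D := [set `|x0 - v| ^+ 2 | v in V].
have Dinf : has_inf D.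
  split; first by exists (`|x0 - 0| ^+ 2), 0.
  by exists 0 => _ [v _ <-]; rewrite sqr_ge0.
pose dd := inf D.
have ddle v : V v -> dd <= `|x0 - v| ^+ 2.
  by move=> Vv; apply: ge_inf; [exact: Dinf.2|exists v].
have /choice[v vP] n : exists v, V v /\ `|x0 - v| ^+ 2 < dd + n.+1%:R^-1.
  have [_ [v Vv <-] h] := inf_adherent (ltac:(by []) : 0 < n.+1%:R^-1 :> R) Dinf.
  by exists v.
have Vmid u w : V u -> V w -> V (2^-1 *: (u + w)).
  move=> Vu Vw; have -> : 2^-1 *: (u + w) = 2^-1 *: (u + w) + 0 by rewrite addr0.
  by apply: (VL 2^-1) => //; rewrite -[u]scale1r; exact: VL.
(* By the parallelogram identity two near-minimizers are close to each other, since their midpoint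
   is in [V] and so at squared distance at least [dd] from [x0]. *)
have dist u w e : V u -> V w -> `|x0 - u| ^+ 2 < dd + e ->
    `|x0 - w| ^+ 2 < dd + e -> `|u - w| ^+ 2 < 4 * e.
  move=> Vu Vw hu hw.
  have := parallelogram (x0 - u) (x0 - w).
  have -> : x0 - u - (x0 - w) = w - u by rewrite opprB addrC subrKA.
  have -> : x0 - u + (x0 - w) = 2%:R *: (x0 - 2^-1 *: (u + w)).
    rewrite scalerBr scalerA divff ?pnatr_eq0// scale1r.
    by rewrite scaler_nat mulr2n addrACA opprD.
  rewrite normrZ exprMn ger0_norm// (distrC w).
  by have := ddle _ (Vmid _ _ Vu Vw) => h1 h2; lra.
have cv : cvg (v n @[n --> \oo]).
  apply/cauchy_cvgP/cauchy_exP => e e0.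
  have e4 : 0 < e ^+ 2 / 4 by rewrite divr_gt0// exprn_gt0.
  have [N _ NP] := near_infty_natSinv_lt (PosNum e4).
  exists (v N); exists N => // n /= Nn; rewrite -ball_normE/=.
  have := dist (v N) (v n) (e ^+ 2 / 4) (vP N).1 (vP n).1.
  rewrite -(ltr_pXn2r (ltn0Sn 1)) ?nnegrE ?(ltW e0)// => h.
  have : `|v N - v n| ^+ 2 < 4 * (e ^+ 2 / 4).
    by apply: h; rewrite (lt_trans (vP _).2)// ltrD2l; apply: NP => /=.
  by move=> /lt_le_trans; apply; rewrite mulrCA divff// mulr1.
pose w := lim (v n @[n --> \oo]).
have Vw : V w.
  by apply: (@closed_cvg _ _ \oo _ v V Vc _ w cv); apply: nearW => n; exact: (vP n).1.
have hw : `|x0 - w| ^+ 2 <= dd.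
  have c1 : `|x0 - v n| ^+ 2 @[n --> \oo] --> `|x0 - w| ^+ 2.
    rewrite expr2; under eq_fun do rewrite expr2.
    by apply: cvgM; apply: cvg_norm; apply: cvgB => //; exact: cvg_cst.
  have c2 : dd + n.+1%:R^-1 @[n --> \oo] --> dd + 0.
    by apply: cvgD; [exact: cvg_cst|exact: cvg_harmonic].
  rewrite -[dd]addr0; apply: (ler_cvg_to c1 c2).
  by apply: nearW => n; rewrite ltW// (vP n).2.
exists (x0 - w).
  by apply: contra_not_neq x0V => /subr0_eq ->.
move=> u Vu.
have key a : dd <= `|x0 - w| ^+ 2 - 2 * a * ip u (x0 - w) + a ^+ 2 * `|u| ^+ 2.
  have -> : `|x0 - w| ^+ 2 - 2 * a * ip u (x0 - w) + a ^+ 2 * `|u| ^+ 2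
    = `|x0 - (a *: u + w)| ^+ 2.
    have -> : x0 - (a *: u + w) = (x0 - w) - a *: u.
      by rewrite opprD addrA addrAC.
    rewrite -!hip; move: (x0 - w) => y.
    by rewrite !(ipBl, ipBr, ipZl, ipZr) (ipC y u); ring.
  by apply: ddle; exact: VL.
set c := ip u (x0 - w).
have [//|c0] := eqVneq c 0.
(* Near the minimizer of the quadratic in [a]; the [+ 1] keeps the denominator positive when [u = 0]
   and still makes the quadratic drop below [dd] unless [c = 0]. *)
have := key (c / (`|u| ^+ 2 + 1)); rewrite -/c.
set n := `|u| ^+ 2 => h.
have n0 : 0 <= n by rewrite sqr_ge0.
have n1 : n + 1 != 0 by rewrite gt_eqF// ltr_wpDl.
have : 2 * (c / (n + 1)) * c - (c / (n + 1)) ^+ 2 * n <= 0 by lra.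
have -> : 2 * (c / (n + 1)) * c - (c / (n + 1)) ^+ 2 * n =
  (c / (n + 1)) ^+ 2 * (n + 2) by field.
rewrite leNgt => /negP; case; rewrite mulr_gt0 ?ltr_wpDl// exprn_even_gt0//.
by rewrite mulf_neq0// invr_neq0.
Qed.

(** Unless [f] vanishes, its kernel is a proper closed subspace. A vector [z] orthogonal to it
    determines [f], because [x - (f x / f z) z] is in the kernel for every [x]. *)
Lemma riesz (f : H -> R) M : linear (f : H -> R^o) ->
  (forall x, `|f x| <= M * `|x|) -> exists eta, forall x, f x = ip x eta.
Proof.
move=> fL fM.
have fD x y : f (x + y) = f x + f y.
  by have := fL 1 x y; rewrite !scale1r.
have f0 : f 0 = 0.
  by have := fD 0 0; rewrite addr0 => /eqP; rewrite -subr_eq0 opprD addNKr oppr_eq0 => /eqP.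
have fZ a x : f (a *: x) = a * f x.
  by have := fL a x 0; rewrite !addr0 f0 addr0.
have fB x y : f (x - y) = f x - f y.
  by rewrite -scaleN1r fD fZ mulN1r.
pose V := [set x | f x = 0].
have [VT|] := eqVneq V setT.
  exists 0 => x; rewrite ipC ip0l.
  by have : V x by rewrite VT.
move=> /(@exists_orthogonal V) [||z z0 zP].
- split => //= a x y; by rewrite /V/= fD fZ => -> ->; rewrite mulr0 addr0.
- rewrite (_ : V = f @^-1` [set 0]) //; apply: preimage_closed => //.
  move=> x _; apply/(@cvgrPdist_le _ _ _ (nbhs x)) => e e0.
  have d0 : 0 < e / (`|M| + 1) by rewrite divr_gt0// ltr_wpDl.
  near=> y; rewrite -fB (le_trans (fM _))//.
  have : `|x - y| <= e / (`|M| + 1) by near: y; exact: cvgr_dist_le.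
  move=> /(ler_wpM2l (normr_ge0 M)) h.
  rewrite (le_trans (ler_wpM2r (normr_ge0 _) (ler_norm M)))// (le_trans h)//.
  by rewrite mulrA ler_pdivrMr ?ltr_wpDl// mulrC ler_wpM2l ?(ltW e0)// lerDl.
- have n0 : `|z| ^+ 2 != 0 by rewrite expf_neq0// normr_eq0.
  have fz : f z != 0.
    by apply: contra_neq n0 => fz0; rewrite -hip zP.
  exists ((f z / `|z| ^+ 2) *: z) => x.
  have : ip (x - (f x / f z) *: z) z = 0.
    by apply: zP; rewrite /V/= fB fZ divfK// subrr.
  rewrite ipBl ipZl ipZr hip => /eqP; rewrite subr_eq0 => /eqP ->.
  by field; rewrite fz normr_eq0 z0.
Unshelve. all: by end_near. Qed.

End InnerProduct.

(** * Semigroups and the domain of the adjoint generator *)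

Section Semigroup.
Context {R : realType} {H : completeNormedModType R}.
Variable U : R -> H -> H.
Hypothesis hU : C0_semigroup U.
Implicit Types (x y z : H) (s t h : R).

Lemma linear_continuous_bound (V W : normedModType R) (g : V -> W) :
  linear g -> continuous g -> exists2 M, 0 < M & forall x : V, `|g x| <= M * `|x|.
Proof.
move=> lg cg.
pose gl : {linear V -> W} := HB.pack g (GRing.isLinear.Build _ _ _ _ _ lg).
have /linear_boundedP[M [_ MP]] : bounded_near gl (nbhs 0).
  exact/linear_bounded_continuous.
exists (`|M| + 1); first by rewrite ltr_wpDl.
by apply: MP; rewrite (le_lt_trans (ler_norm _))// ltrDl.
Qed.

Lemma right_limit_bound (K : normedModType R) (f : R -> K) (l : K) e :
  f t @[t --> 0^'+] --> l -> 0 < e ->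
  exists2 r, 0 < r & forall t, 0 < t -> t < r -> `|f t - l| <= e.
Proof.
move=> fl e0.
have : \forall t \near 0^'+, `|f t - l| <= e by exact: cvgr_distC_le.
rewrite near_withinE => /nbhs_normP[r /= r0 rP].
by exists r => // t t0 tr; apply: rP => //=; rewrite sub0r normrN gtr0_norm.
Qed.

Lemma semigroup_near0 x e : 0 < e ->
  exists2 r, 0 < r & forall t, 0 <= t -> t < r -> `|U t x - x| <= e.
Proof.
move=> e0; have [r r0 rP] := right_limit_bound (@C0_continuous _ _ _ hU x) e0.
exists r => // t; rewrite le_eqVlt => /predU1P[<- _|]; last exact: rP.
by rewrite (C0_id hU) subrr normr0 ltW.
Qed.

(** Otherwise there are times [t n] tending to 0 at which the operator norm exceeds [n + 1]. Strong
    continuity at 0 bounds each orbit along these times, so Banach-Steinhaus gives a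
    contradiction. *)
Lemma semigroup_locally_bounded : exists d M, [/\ 0 < d, 0 < M &
  forall t, 0 <= t -> t <= d -> forall x, `|U t x| <= M * `|x|].
Proof.
apply: contrapT => nex.
have /choice[t tP] (n : nat) : exists t, [/\ 0 <= t, t <= n.+1%:R^-1 &
    exists x, n.+1%:R * `|x| < `|U t x|].
  apply: contrapT => nt; apply: nex; exists n.+1%:R^-1, n.+1%:R; split => // t t0 tn x.
  rewrite leNgt; apply/negP => ltU; apply: nt; exists t; split => //.
  by exists x.
have BS : uniform_bounded [set f | exists n, f = U (t n)].
  apply: Banach_Steinhauss.
    move=> _ [n ->]; have [t0 _ _] := tP n; split; last exact: (C0_linear hU).
    have [M M0 MP] := linear_continuous_bound (C0_linear hU t0) (C0_bounded hU t0).
    move=> r; exists (M * r) => x xr.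
    by rewrite (le_trans (MP _))// ler_wpM2l// ltW.
  move=> x; have [r r0 rP] := semigroup_near0 x ltr01.
  have [N _ NP] := near_infty_natSinv_lt (PosNum r0).
  (* The sum covers the finitely many times before [N]; from [N] on, [U (t n) x] is within 1 of
     [x]. *)
  exists (\sum_(i < N) `|U (t i) x| + (`|x| + 1)) => _ [n ->].
  have [nN|Nn] := ltnP n N.
    rewrite (bigD1 (Ordinal nN))//= -addrA lerDl.
    by rewrite !addr_ge0// sumr_ge0.
  rewrite -[leLHS]add0r lerD ?sumr_ge0//.
  rewrite -(subrK x (U (t n) x)) (le_trans (ler_normD _ _))// addrC lerD2l.
  have [t0 tn _] := tP n; apply: rP => //.
  by rewrite (le_lt_trans tn)//; exact: NP.
have [M MP] := BS 1.
have [n nM] : exists n : nat, M < n.+1%:R.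
  by exists (Num.truncn M); exact: truncnS_gt.
have [t0 _ [x xP]] := tP n.
have x0 : x != 0.
  apply: contraTneq xP => ->; rewrite normr0 mulr0 -leNgt.
  have [K _ KP] := linear_continuous_bound (C0_linear hU t0) (C0_bounded hU t0).
  by rewrite (le_trans (KP _))// normr0 mulr0.
have nx0 : 0 < `|x| by rewrite normr_gt0.
have : `|U (t n) (`|x|^-1 *: x)| <= M.
  apply: MP; first by exists n.
  by rewrite normrZ ger0_norm ?invr_ge0// mulVf// normr_eq0.
have UZ : U (t n) (`|x|^-1 *: x) = `|x|^-1 *: U (t n) x.
  have L := C0_linear hU t0.
  have U0 : U (t n) 0 = 0.
    by have := L (-1) 0 0; rewrite scaler0 addr0 scaleN1r addNr.
  by have := L (`|x|^-1) x 0; rewrite addr0 U0 addr0.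
rewrite UZ normrZ ger0_norm ?invr_ge0// ler_pdivrMl// leNgt => /negP; apply.
by rewrite (lt_trans _ xP)// mulrC ltr_pM2r.
Qed.

End Semigroup.

Section AdjointDomain.
Context {R : realType} {H : completeNormedModType R} (ip : {dot H for idfun}).
Hypothesis hip : induces_norm ip.
Variables (U : R -> H -> H) (A : operator H).
Hypotheses (hU : C0_semigroup U) (hA : is_generator U A).
Implicit Types (x y z phi : H) (s t h : R).

Let UB t x y : 0 <= t -> U t (x - y) = U t x - U t y.
Proof.
by move=> t0; rewrite addrC -scaleN1r (C0_linear hU t0) scaleN1r addrC.
Qed.

Let U0 t : 0 <= t -> U t 0 = 0.
Proof. by move=> t0; have := UB 0 0 t0; rewrite !subrr. Qed.

Let UZ t a x : 0 <= t -> U t (a *: x) = a *: U t x.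
Proof. by move=> t0; have := C0_linear hU t0 a x 0; rewrite !addr0 U0// addr0. Qed.

Variables (d M : R).
Hypotheses (d0 : 0 < d) (M0 : 0 < M).
Hypothesis UM : forall t, 0 <= t -> t <= d -> forall x, `|U t x| <= M * `|x|.

(** Since [U t x - U s x = U s (U (t - s) x - x)], the bound [M] transports continuity at time 0 to
    every time of [[0, d]]. *)
Let U_shift s t x : 0 <= s -> s <= t -> t <= d ->
  `|U t x - U s x| <= M * `|U (t - s) x - x|.
Proof.
move=> s0 st td.
rewrite -{1}(subrK s t) [t - s + s]addrC (C0_add hU) ?subr_ge0// -UB//.
by apply: UM => //; exact: le_trans td.
Qed.

(* [U] is meaningful at nonnegative times and bounded on [0, d] only; clamping
   makes the orbits continuous on the whole line. *)
Let clamp s := Num.min (Num.max s 0) d.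

Let clamp_ge0 s : 0 <= clamp s.
Proof. by rewrite /clamp le_min le_max lexx orbT ltW. Qed.

Let clamp_led s : clamp s <= d.
Proof. by rewrite /clamp ge_min lexx orbT. Qed.

Let clampE s : 0 <= s -> s <= d -> clamp s = s.
Proof. by move=> s0 sd; rewrite /clamp max_l// min_l. Qed.

Let clamp_dist s t : s <= t -> 0 <= clamp t - clamp s <= t - s.
Proof.
move=> st; rewrite /clamp !minEle !maxEle.
by do ! case: ifPn; rewrite -?ltNge => *; lra.
Qed.

Let orbit_continuous x phi : continuous (fun s => ip (U (clamp s) x) phi).
Proof.
have C0 : 0 < M * (`|phi| + 1) by rewrite mulr_gt0// ltr_wpDl.
move=> s; apply/cvgrPdist_le => e e0.
have [r r0 rP] := semigroup_near0 hU x (divr_gt0 e0 C0).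
have main a b : a <= b -> b - a < r ->
    `|ip (U (clamp b) x) phi - ip (U (clamp a) x) phi| <= e.
  move=> ab bar; have /andP[c0 c1] := clamp_dist ab.
  rewrite -ipBl (le_trans (ip_le_norm hip _ _))//.
  have := U_shift x (clamp_ge0 a) (ltac:(lra) : clamp a <= clamp b) (clamp_led b).
  have := rP _ c0 (le_lt_trans c1 bar).
  set p := `|U _ x - x|; set q := `|U _ x - U _ x|; rewrite ler_pdivlMr// => h1 h2.
  have : q * `|phi| <= M * p * (`|phi| + 1).
    by apply: ler_pM; rewrite ?normr_ge0 ?lerDl.
  by move=> /le_trans; apply; rewrite mulrAC mulrC.
apply/nbhs_normP; exists r => //= t; rewrite /= => str.
have [st|/ltW ts] := leP s t.
  by rewrite distrC main//; move: str; rewrite distrC ger0_norm// subr_ge0.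
by rewrite main//; move: str; rewrite ger0_norm// subr_ge0.
Qed.

(** For [h] in [[0, d]] this is the pairing of [x] with the weak integral of [U(s)^* phi] over
    [[0, h]]. *)
Let Int x phi h := \int[lebesgue_measure]_(s in `[0, h]) ip (U (clamp s) x) phi.

Let orbit_integrable x phi h :
  lebesgue_measure.-integrable `[0, h] (EFin \o (fun s => ip (U (clamp s) x) phi)).
Proof.
apply: continuous_compact_integrable; first exact: segment_compact.
exact: continuous_subspaceT (@orbit_continuous x phi).
Qed.

Let Int_riesz phi h : 0 <= h -> exists eta, forall x, Int x phi h = ip x eta.
Proof.
move=> h0; apply: (@riesz _ _ ip hip (fun x => Int x phi h) (M * `|phi| * h)).
- move=> a x y; transitivity (a * Int x phi h + Int y phi h); last by [].
  have iax : lebesgue_measure.-integrable `[0, h]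
      (EFin \o (fun s => a * ip (U (clamp s) x) phi)).
    have := orbit_integrable x phi h.
    by move/(@integrableZl _ _ _ lebesgue_measure _ (measurable_itv _) a).
  rewrite /Int -RintegralZl//.
  rewrite -RintegralD//.
  apply: eq_Rintegral => s _.
  by rewrite (C0_linear hU (clamp_ge0 s)) ipDl ipZl.
- move=> x; rewrite /Int (le_trans (le_normr_Rintegral _ _))//.
  apply: (@le_trans _ _ (\int[lebesgue_measure]_(s in `[0, h])
    (M * `|x| * `|phi|))).
    apply: le_Rintegral => //.
    + exact: integrable_norm (orbit_integrable x phi h).
    + apply: continuous_compact_integrable; first exact: segment_compact.
      by apply: continuous_subspaceT => ?; exact: cvg_cst.
    + move=> s _; rewrite (le_trans (ip_le_norm hip _ _))//.
      by rewrite ler_wpM2r// UM.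
  rewrite Rintegral_cst//= lebesgue_measure_itv/= lte_fin.
  case: ltP => h0' /=; first by rewrite oppr0 addr0; lra.
  by rewrite mulr0 !mulr_ge0// ltW.
Qed.

Let U_riesz phi t : 0 <= t -> exists eta, forall x, ip (U t x) phi = ip x eta.
Proof.
move=> t0.
have [K K0 KP] := linear_continuous_bound (C0_linear hU t0) (C0_bounded hU t0).
apply: (@riesz _ _ ip hip (fun x => ip (U t x) phi) (K * `|phi|)).
  by move=> a x y /=; rewrite (C0_linear hU t0) ipDl ipZl.
move=> x; rewrite (le_trans (ip_le_norm hip _ _))// mulrAC.
by rewrite ler_wpM2r.
Qed.

(* [s] may be either end point, which yields both one-sided derivatives of the
   orbit. *)
Let orbit_quotient x s1 s2 s : 0 <= s1 -> s1 < s2 -> s2 <= d ->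
    s = s1 \/ s = s2 ->
  `|(s2 - s1)^-1 *: (U s2 x - U s1 x) - U s (A x)| <=
  M * (`|(s2 - s1)^-1 *: (U (s2 - s1) x - x) - A x|
       + `|U (s2 - s1) (A x) - A x|).
Proof.
move=> s10 s12 s2d ss; set j := s2 - s1.
have j0 : 0 <= j by rewrite subr_ge0 ltW.
have s1d : s1 <= d by rewrite (le_trans (ltW s12)).
have s2E y : U s2 y = U s1 (U j y) by rewrite -(C0_add hU)// /j addrC subrK.
rewrite s2E -UB// -UZ//; case: ss => ->; last rewrite s2E; rewrite -UB//;
  apply: (le_trans (UM s10 s1d _)); apply: ler_wpM2l; rewrite ?(ltW M0)//.
  by rewrite lerDl.
rewrite -[X in `|X| <= _](subrKA (A x)) (le_trans (ler_normD _ _))// lerD2l.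
by rewrite distrC.
Qed.

Let orbit_derivable x phi s : dom A x -> 0 < s -> s < d ->
  is_derive s 1 (fun s => ip (U (clamp s) x) phi) (ip (U (clamp s) (A x)) phi).
Proof.
move=> Ax s0 sd; set f := fun s => _.
have lim0 : h^-1 *: ((f \o shift s) (h *: 1) - f s) @[h --> 0^'] -->
    ip (U (clamp s) (A x)) phi.
  apply/cvgrPdist_le => e e0.
  (* [orbit_quotient] leaves two errors, each amplified by [M] and by the pairing with [phi]; the
     factor 2 allots half of [e] to each. *)
  have C0 : 0 < 2 * (M * (`|phi| + 1)) by rewrite !mulr_gt0// ltr_wpDl.
  have [r1 r10 r1P] := right_limit_bound (((hA x (A x)).1 (conj Ax erefl))) (divr_gt0 e0 C0).
  have [r2 r20 r2P] := semigroup_near0 hU (A x) (divr_gt0 e0 C0).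
  (* The last two bounds keep [s + h] in [[0, d]], where [clamp] is the identity. *)
  pose r := Num.min (Num.min r1 r2) (Num.min s (d - s)).
  have r0 : 0 < r by rewrite !lt_min r10 r20 s0 subr_gt0.
  have main s1 s2 : 0 <= s1 -> s1 < s2 -> s2 <= d -> s2 - s1 < r ->
      s = s1 \/ s = s2 ->
      `|ip (U s (A x)) phi - (s2 - s1)^-1 * (ip (U s2 x) phi - ip (U s1 x) phi)|
      <= e.
    move=> s10 s12 s2d; rewrite !lt_min => /andP[/andP[jr1 jr2] _] ss.
    rewrite -ipBl -ipZl -ipBl (le_trans (ip_le_norm hip _ _))// distrC.
    have := orbit_quotient x s10 s12 s2d ss.
    have j0 : 0 < s2 - s1 by rewrite subr_gt0.
    have := r1P _ j0 jr1; have := r2P _ (ltW j0) jr2.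
    rewrite !ler_pdivlMr//.
    set p2 := `|U _ _ - A x|; set p1 := `|_ - A x|; set n := `|_ - U s _|.
    move=> h2 h1 h3.
    have : n * `|phi| <= M * (p1 + p2) * (`|phi| + 1).
      by apply: ler_pM; rewrite ?normr_ge0 ?lerDl.
    by move=> /le_trans; apply; lra.
  have sc := clampE (ltW s0) (ltW sd).
  apply/nbhs_normP; exists r => //= h; rewrite /ball_ /= sub0r normrN => hr h0.
  have [hs hd] : `|h| < s /\ `|h| < d - s.
    by move: hr; rewrite !lt_min => /andP[_ /andP[]].
  have ch : clamp (h + s) = h + s.
    by apply: clampE; move: hs hd; rewrite !ltr_norml => /andP[? ?] /andP[? ?]; lra.
  rewrite /f/= /shift/= -[h%:A]/(h * 1) mulr1 sc ch.
  have [hlt|hgt|h00] := ltgtP h 0; last by rewrite h00 eqxx in h0.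
  - have := main (h + s) s.
    have -> : s - (h + s) = - h by ring.
    rewrite (_ : (- h)^-1 * _ = h^-1 *: (ip (U (h + s) x) phi - ip (U s x) phi)).
      apply; [|by lra|exact: ltW| |by right].
        by move: hs; rewrite ltr_norml => /andP[? ?]; lra.
      by rewrite -(ltr0_norm hlt).
    by rewrite invrN mulNr -mulrN opprB.
  - have := main s (h + s); rewrite addrK; apply; [exact: ltW|by lra| |by rewrite -(gtr0_norm hgt)|by left].
    by move: hd; rewrite ltr_norml => /andP[? ?]; lra.
split; first exact: cvgP lim0.
exact: cvg_lim lim0.
Qed.

(** The fundamental theorem of calculus along an orbit. Read through adjoints, it says that [A^*]
    sends the weak integral of [U(s)^* phi] to [U(h)^* phi - phi]; in particular that integral is in
    the domain of [A^*]. *)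
Let Int_dom x phi h : dom A x -> 0 < h -> h < d ->
  Int (A x) phi h = ip (U h x) phi - ip x phi.
Proof.
move=> Ax h0 hd; rewrite /Int /Rintegral.
rewrite (@continuous_FTC2 _ _ (fun s => ip (U (clamp s) x) phi))//.
- by rewrite /= !clampE// ?(C0_id hU)// ?ltW.
- exact: continuous_subspaceT (@orbit_continuous (A x) phi).
- split.
  + move=> s; rewrite in_itv/= => /andP[s0 sh].
    by have [] := orbit_derivable phi Ax s0 (lt_trans sh hd).
  + by apply: cvg_at_right_filter; exact: orbit_continuous.
  + by apply: cvg_at_left_filter; exact: orbit_continuous.
- move=> s; rewrite in_itv/= => /andP[s0 sh].
  by rewrite derive1E; have [_] := orbit_derivable phi Ax s0 (lt_trans sh hd).
Qed.

Let dom_adjoint_linear : linear_subspace (dom (adjoint ip A)).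
Proof.
split.
  by exists 0 => x _; rewrite ![ip _ 0]ipC !ip0l.
move=> a x y [ex exP] [ey eyP]; exists (a *: ex + ey) => z Az.
by rewrite !ipDr !ipZr exP// eyP.
Qed.

(** A nonzero [z] orthogonal to the closure would be orthogonal to the weak integral of [U(s)^* z]
    over [[0, h]], that is, [Int z z h = 0]. For small [h] this integral is close to [h * |z|^2],
    which is positive. *)
Lemma closure_dom_adjoint : closure (dom (adjoint ip A)) = setT.
Proof.
apply/eqP; apply/negPn/negP.
move=> /(exists_orthogonal hip (linear_subspace_closure dom_adjoint_linear)).
move=> /(_ (@closed_closure _ _))[z z0 zP].
have Int0 h : 0 < h -> h < d -> Int z z h = 0.
  move=> h0 hd.
  have [ph phP] := Int_riesz z (ltW h0); rewrite phP ipC.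
  apply: zP; apply: subset_closure.
  have [uh uhP] := U_riesz z (ltW h0).
  by exists (uh - z) => x Ax; rewrite -phP Int_dom// ipBr uhP.
have zz : 0 < ip z z by rewrite hip exprn_gt0// normr_gt0.
(* Tolerance [ip z z / 2]: the integrand stays above [ip z z / 2] on a short interval. *)
have /cvgrPdist_le/(_ _ (divr_gt0 zz (ltr0Sn _ 1))) := @orbit_continuous z z 0.
rewrite clampE ?(ltW d0)// (C0_id hU).
move=> /nbhs_normP[r /= r0 rP].
pose h := Num.min r d / 2.
have m0 : 0 < Num.min r d by rewrite lt_min r0.
have h0 : 0 < h by rewrite divr_gt0.
have hr : h < r.
  have : Num.min r d <= r by rewrite ge_min lexx.
  by rewrite /h; lra.
have hd : h < d.
  have : Num.min r d <= d by rewrite ge_min lexx orbT.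
  by rewrite /h; lra.
suff : ip z z / 2 * h <= Int z z h.
  by rewrite Int0// leNgt mulr_gt0// divr_gt0.
have -> : ip z z / 2 * h = \int[lebesgue_measure]_(s in `[0, h]) (ip z z / 2).
  by rewrite Rintegral_cst//= lebesgue_measure_itv/= lte_fin h0 oppr0 addr0.
apply: le_Rintegral => //.
- apply: continuous_compact_integrable; first exact: segment_compact.
  by apply: continuous_subspaceT => ?; exact: cvg_cst.
- move=> s /=; rewrite in_itv/= => /andP[s0 sh].
  have := rP s; rewrite /= sub0r normrN ger0_norm// => /(_ (le_lt_trans sh hr)).
  by rewrite ler_norml => /andP[_]; lra.
Qed.

End AdjointDomain.

Lemma dense_dom_adjoint (R : realType) (H : completeNormedModType R)
    (ip : {dot H for idfun}) (U : R -> H -> H) (A : operator H) :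
  induces_norm ip -> C0_semigroup U -> is_generator U A ->
  forall eta e, 0 < e -> exists2 phi, dom (adjoint ip A) phi & `|eta - phi| < e.
Proof.
move=> hip hU hA eta e e0.
have [d [M [d0 M0 UM]]] := semigroup_locally_bounded hU.
have : closure (dom (adjoint ip A)) eta.
  by rewrite (closure_dom_adjoint hip hU hA d0 M0 UM).
move=> /(_ _ (nbhsx_ballx eta _ e0))[phi [dphi ephi]].
by exists phi => //; move: ephi; rewrite -ball_normE.
Qed.

(** * Variance of the normal law *)

Section NormalVariance.
Context {R : realType}.
Variable s : R.
Hypothesis s0 : 0 < s.
Local Notation mu := (@lebesgue_measure R).
Implicit Types x : R.

Let phi := @normal_pdf R 0 s.

Let phiE x : phi x = normal_peak s * expR (- (2 * s ^+ 2)^-1 * x ^+ 2).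
Proof.
rewrite /phi normal_pdfE ?gt_eqF// /normal_fun subr0; congr (_ * expR _).
by rewrite -mulr_natl mulNr mulrC mulNr.
Qed.

Let phi_continuous : continuous phi.
Proof. by apply: continuous_normal_pdf; rewrite gt_eqF. Qed.

Let is_derive_phi x : is_derive x 1 phi (- (s ^+ 2)^-1 * x * phi x).
Proof.
have -> : phi = (fun x => normal_peak s * expR (- (2 * s ^+ 2)^-1 * x ^+ 2)).
  by apply/funext => y; exact: phiE.
have h : is_derive x 1 (fun x => - (2 * s ^+ 2)^-1 * x ^+ 2) (- (s ^+ 2)^-1 * x).
  apply: is_derive_eq.
  by rewrite /GRing.scale/=; field; rewrite gt_eqF//.
have h2 := @is_derive1_comp _ expR (fun x => - (2 * s ^+ 2)^-1 * x ^+ 2) x _ _ _ h.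
have h3 := h2 _ (is_derive_expR _).
apply: is_derive_eq.
rewrite /GRing.scale/=; ring.
Qed.

(** From [phi' = - x phi / s^2] this is a primitive of [(x^2 - s^2) phi]. It vanishes at 0 and at
    infinity, so [x^2 phi] and [s^2 phi] have the same integral. *)
Let F x := - s ^+ 2 * (x * phi x).

Let is_derive_F x : is_derive x 1 F ((x ^+ 2 - s ^+ 2) * phi x).
Proof.
have h := is_derive_phi x; rewrite /F; apply: is_derive_eq.
by rewrite /GRing.scale/=; field; rewrite gt_eqF.
Qed.

Let s2_gt0 : 0 < s ^+ 2. Proof. exact: exprn_gt0. Qed.

Let phi_ge0 x : 0 <= phi x. Proof. exact: normal_pdf_ge0. Qed.

(** Uses [exp (- u) <= 1 / u] at [u = x^2 / (2 s^2)], enough for the decay of [F]. *)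
Let F_bound x : 0 < x -> `|F x| <= 2 * s ^+ 4 * normal_peak s / x.
Proof.
move=> x0; rewrite /F normrM normrN (ger0_norm (ltW s2_gt0)) ger0_norm; last first.
  by rewrite mulr_ge0// ltW.
rewrite phiE mulNr expRN.
set u := _ * x ^+ 2; have u0 : 0 < u by rewrite mulr_gt0 ?invr_gt0 ?mulr_gt0 ?exprn_gt0.
have : (expR u)^-1 <= u^-1.
  by rewrite lef_pV2 ?posrE ?expR_gt0// (le_trans _ (expR_ge1Dx u))// lerDr.
move=> /(ler_wpM2l (_ : 0 <= s ^+ 2 * (x * normal_peak s))) h.
have p0 := normal_peak_ge0 s.
rewrite mulrA [_ * (x * _)]mulrA in h *.
rewrite (le_trans (le_trans _ (h _)))//.
- by rewrite !mulrA.
- by rewrite !mulr_ge0// ltW.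
- rewrite /u le_eqVlt; apply/orP; left; apply/eqP.
  by field; rewrite !gt_eqF.
Qed.

Let cvgF : F x @[x --> +oo] --> (0 : R).
Proof.
apply/cvgr0Pnorm_le => e e0.
have p0 := normal_peak_ge0 s.
near=> x.
have x0 : 0 < x by near: x; exact: nbhs_pinfty_gt.
rewrite (le_trans (F_bound x0))// ler_pdivrMr// -ler_pdivrMl//.
Unshelve. all: by end_near. Qed.

Let cont_x2 : continuous (fun x : R => x ^+ 2 * phi x).
Proof. by move=> x; apply: cvgM; [exact: exprn_continuous|exact: phi_continuous]. Qed.

Let cont_f : continuous (fun x : R => (x ^+ 2 - s ^+ 2) * phi x).
Proof.
move=> x; apply: cvgM; last exact: phi_continuous.
by apply: cvgB; [exact: exprn_continuous|exact: cvg_cst].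
Qed.

Let cont_c : continuous (fun x : R => s ^+ 2 * phi x).
Proof. by move=> x; apply: cvgM; [exact: cvg_cst|exact: phi_continuous]. Qed.

Let cont_F : continuous F.
Proof.
move=> x; apply: differentiable_continuous; apply/derivable1_diffP.
by have [] := is_derive_F x.
Qed.

(* The integrand [(x ^+ 2 - s ^+ 2) * phi x] with primitive [F] changes sign at [s];
   [F s] cancels when the two pieces are added. *)
Let int_f_0s :
  (\int[mu]_(x in `[0%R, s]) ((x ^+ 2 - s ^+ 2) * phi x)%:E = (F s)%:E)%E.
Proof.
rewrite (@continuous_FTC2 _ _ F 0 s)//.
- by rewrite [F 0]/F mul0r mulr0 sube0.
- exact: continuous_subspaceT.
- split.
  + by move=> x _; have [] := is_derive_F x.
  + by apply: cvg_at_right_filter; exact: cont_F.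
  + by apply: cvg_at_left_filter; exact: cont_F.
- by move=> x _; rewrite derive1E; have [_] := is_derive_F x.
Qed.

Let int_f_sy :
  (\int[mu]_(x in `[s, +oo[) ((x ^+ 2 - s ^+ 2) * phi x)%:E = (- F s)%:E)%E.
Proof.
rewrite (@ge0_continuous_FTC2y _ _ F s 0)//.
- by rewrite add0e.
- move=> x sx; rewrite mulr_ge0// subr_ge0 ler_sqr ?nnegrE ?(ltW s0)//.
  exact: le_trans (ltW s0) sx.
- exact: continuous_subspaceT.
- by move=> x _; have [] := is_derive_F x.
- by apply: cvg_at_right_filter; exact: cont_F.
- by move=> x _; rewrite derive1E; have [_] := is_derive_F x.
Qed.

Let split_half (g : R -> R) : (forall x, 0 <= g x) -> continuous g ->
  (\int[mu]_(x in [set x | (0 <= x)%R]) (g x)%:E =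
   \int[mu]_(x in `[0%R, s]) (g x)%:E + \int[mu]_(x in `[s, +oo[) (g x)%:E)%E.
Proof.
move=> g0 cg.
have mg (D : set R) : measurable_fun D (fun x => (g x)%:E).
  by apply/measurable_EFinP/measurable_funTS; exact: continuous_measurable_fun.
rewrite -(integral_itv_obnd_cbnd (mg _)) -ge0_integral_setU//=.
- congr integral; rewrite -itv_bndbnd_setU ?bnd_simp ?(ltW s0)//.
  by apply/seteqP; split => x /=; rewrite in_itv/= andbT.
- exact: mg.
- by move=> x _; rewrite lee_fin.
- apply/disj_setPS => y [/=]; rewrite 2!in_itv/= => /andP[_ ys] /andP[].
  by rewrite ltNge ys.
Qed.

Lemma normal_pdf_second_moment :
  (\int[mu]_x (x ^+ 2 * normal_pdf 0 s x)%:E = (s ^+ 2)%:E)%E.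
Proof.
have even g : g =1 g \o -%R -> (fun x => g x * phi x) =1 (fun x => g x * phi x) \o -%R.
  by move=> gE x /=; rewrite {1}gE/= !phiE sqrrN.
have mE (g : R -> R) (D : set R) : continuous g -> measurable_fun D (fun x => (g x)%:E).
  by move=> cg; apply/measurable_EFinP/measurable_funTS; exact: continuous_measurable_fun.
have x20 x : 0 <= x ^+ 2 * phi x by rewrite mulr_ge0// sqr_ge0.
have c0 x : 0 <= s ^+ 2 * phi x by rewrite mulr_ge0// ltW.
transitivity (\int[mu]_x (s ^+ 2 * phi x)%:E)%E; last first.
  under eq_integral do rewrite EFinM.
  rewrite ge0_integralZl//; first by rewrite integral_normal_pdf mule1.
  - exact: mE.
  - by move=> x _; rewrite lee_fin.
  - by rewrite lee_fin ltW.
rewrite !ge0_symfun_integralT//; last 2 first.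
- by apply: (even (fun=> s ^+ 2)).
- by apply: (even (fun x => x ^+ 2)) => x /=; rewrite sqrrN.
congr (_ * _)%E; rewrite !split_half//.
have ci (g : R -> R) : continuous g -> mu.-integrable `[0, s] (EFin \o g).
  move=> cg; apply: continuous_compact_integrable; first exact: segment_compact.
  exact: continuous_subspaceT.
(* On [[0, s]] the difference is negative, and additivity rests on integrability over a compact set;
   on [[s, +oo[] it is nonnegative, and additivity holds without knowing finiteness. *)
have e0 : (\int[mu]_(x in `[0%R, s]) (x ^+ 2 * phi x)%:E =
    (F s)%:E + \int[mu]_(x in `[0%R, s]) (s ^+ 2 * phi x)%:E)%E.
  rewrite -int_f_0s -integralD_EFin//; [|exact: ci|exact: ci].
  by apply: eq_integral => x _; rewrite -EFinD; congr EFin; ring.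
have ey : (\int[mu]_(x in `[s, +oo[) (x ^+ 2 * phi x)%:E =
    (- F s)%:E + \int[mu]_(x in `[s, +oo[) (s ^+ 2 * phi x)%:E)%E.
  rewrite -int_f_sy -ge0_integralD//.
  - by apply: eq_integral => x _; rewrite -EFinD; congr EFin; ring.
  - move=> x /=; rewrite in_itv/= andbT lee_fin => sx.
    rewrite mulr_ge0// subr_ge0 ler_sqr ?nnegrE ?(ltW s0)//.
    exact: le_trans (ltW s0) sx.
  - exact: mE.
  - by move=> x _; rewrite lee_fin.
  - exact: mE.
rewrite e0 ey addeACA -EFinD subrr add0e.
by [].
Qed.

Lemma normal_prob_second_moment :
  (\int[normal_prob 0 s]_x (x ^+ 2)%:E = (s ^+ 2)%:E)%E.
Proof.
have dom := normal_prob_dominates 0 s.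
have mx2 : measurable_fun [set: R] (fun x : R => (x ^+ 2)%:E).
  by apply/measurable_EFinP; exact: measurable_funX.
rewrite -(Radon_Nikodym_SigmaFinite.change_of_variables dom)//; last first.
  by move=> x; rewrite lee_fin sqr_ge0.
rewrite -normal_pdf_second_moment; apply: ae_eq_integral => //.
- apply: emeasurable_funM => //.
  exact: measurable_int (Radon_Nikodym_SigmaFinite.f_integrable dom).
- apply/measurable_EFinP; apply: continuous_measurable_fun; exact: cont_x2.
(* The Radon-Nikodym derivative equals the explicit density almost everywhere, both having the same
   integral over each measurable set. *)
- rewrite (_ : (fun x => (x ^+ 2 * _)%:E) =
    (fun x => (x ^+ 2)%:E * (normal_pdf 0 s x)%:E)%E)//.
  apply: ae_eqe_mul2l; apply: integral_ae_eq => //=.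
  + exact: Radon_Nikodym_SigmaFinite.f_integrable.
  + by apply/measurable_EFinP; exact: measurable_normal_pdf.
  + move=> E _ mE; rewrite -Radon_Nikodym_SigmaFinite.f_integral//.
Qed.

End NormalVariance.

(** * Square-integrable functions *)

Section SquareIntegrable.
Context {d} {T : measurableType d} {R : realType}.
Variables (mu : {measure set T -> \bar R}) (D : set T).
Hypothesis mD : measurable D.
Implicit Types (f g h : T -> R) (a : R).

Definition sqint f :=
  measurable_fun D f /\ mu.-integrable D (EFin \o (fun x => f x ^+ 2)).

Definition dotp f g := \int[mu]_(x in D) (f x * g x).

Definition norm2 f := Num.sqrt (dotp f f).

Lemma sqintP f : measurable_fun D f ->
  (\int[mu]_(x in D) (f x ^+ 2)%:E < +oo)%E -> sqint f.
Proof.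
move=> mf fy; split => //; apply/integrableP; split.
  by apply/measurable_EFinP; exact: measurable_funX.
rewrite (eq_integral (fun x => (f x ^+ 2)%:E))// => x _ /=.
by rewrite ger0_norm// sqr_ge0.
Qed.

Lemma sqintM f g : sqint f -> sqint g ->
  mu.-integrable D (EFin \o (fun x => f x * g x)).
Proof.
move=> [mf f2] [mg g2].
apply: (@le_integrable _ _ _ mu D mD _ (EFin \o (fun x => f x ^+ 2 + g x ^+ 2))).
- by apply/measurable_EFinP; exact: measurable_funM.
- move=> x _ /=; rewrite lee_fin [leRHS]ger0_norm ?addr_ge0 ?sqr_ge0//.
  have := sqr_ge0 (`|f x| - `|g x|); rewrite sqrrB !real_normK ?num_real// normrM.
  have : 0 <= `|f x| * `|g x| by rewrite mulr_ge0.
  by rewrite mulr2n; lra.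
- exact: (integrableD mD f2 g2).
Qed.

Lemma sqint_cst a : (mu D < +oo)%E -> sqint (fun=> a).
Proof.
move=> Dy; apply: sqintP => //; rewrite integral_cst//.
by rewrite lte_mul_pinfty// lee_fin sqr_ge0.
Qed.

Lemma sqint_integrable f : (mu D < +oo)%E -> sqint f ->
  mu.-integrable D (EFin \o f).
Proof.
move=> Dy sf; have := sqintM sf (sqint_cst 1 Dy).
by rewrite (_ : (fun x => f x * 1) = f)//; apply/funext => x; rewrite mulr1.
Qed.

Lemma sqintZ a f : sqint f -> sqint (fun x => a * f x).
Proof.
move=> [mf f2]; split; first exact: measurable_funM.
rewrite (_ : _ \o _ = (fun x => (a ^+ 2)%:E * (f x ^+ 2)%:E)%E).
  exact: integrableZl.
by apply/funext => x /=; rewrite exprMn.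
Qed.

Lemma sqintD f g : sqint f -> sqint g -> sqint (f \+ g).
Proof.
move=> sf sg; have ifg := sqintM sf sg; move: sf sg => [mf f2] [mg g2].
split; first exact: measurable_funD.
rewrite (_ : _ \o _ = ((EFin \o (fun x => f x ^+ 2)%R) \+
  ((EFin \o (fun x => f x * g x)%R) \+ (EFin \o (fun x => f x * g x)%R)) \+
  (EFin \o (fun x => g x ^+ 2)%R))%E).
  by do !apply: integrableD.
by apply/funext => x /=; rewrite -!EFinD; congr EFin; ring.
Qed.

Lemma sqintB f g : sqint f -> sqint g -> sqint (f \- g).
Proof.
move=> sf sg; rewrite (_ : f \- g = f \+ (fun x => -1 * g x)).
  by apply: sqintD => //; exact: sqintZ.
by apply/funext => x /=; rewrite mulN1r.
Qed.

Lemma dotpC f g : dotp f g = dotp g f.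
Proof. by apply: eq_Rintegral => x _; rewrite mulrC. Qed.

Lemma dotpDl f g h : sqint f -> sqint g -> sqint h ->
  dotp (f \+ g) h = dotp f h + dotp g h.
Proof.
move=> sf sg sh; rewrite -RintegralD//; [|exact: sqintM..].
by apply: eq_Rintegral => x _ /=; rewrite mulrDl.
Qed.

Lemma dotpBl f g h : sqint f -> sqint g -> sqint h ->
  dotp (f \- g) h = dotp f h - dotp g h.
Proof.
move=> sf sg sh; rewrite -RintegralB//; [|exact: sqintM..].
by apply: eq_Rintegral => x _ /=; rewrite mulrBl.
Qed.

Lemma dotpZl a f h : sqint f -> sqint h ->
  dotp (fun x => a * f x) h = a * dotp f h.
Proof.
move=> sf sh; rewrite -RintegralZl//; last exact: sqintM.
by apply: eq_Rintegral => x _ /=; rewrite mulrA.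
Qed.

Lemma dotpDr f g h : sqint f -> sqint g -> sqint h ->
  dotp f (g \+ h) = dotp f g + dotp f h.
Proof. by move=> *; rewrite dotpC dotpDl// !(dotpC f). Qed.

Lemma dotpBr f g h : sqint f -> sqint g -> sqint h ->
  dotp f (g \- h) = dotp f g - dotp f h.
Proof. by move=> *; rewrite dotpC dotpBl// !(dotpC f). Qed.

Lemma dotpZr a f h : sqint f -> sqint h ->
  dotp h (fun x => a * f x) = a * dotp h f.
Proof. by move=> *; rewrite dotpC dotpZl// dotpC. Qed.

Lemma dotp_ge0 f : 0 <= dotp f f.
Proof. by apply: Rintegral_ge0 => x _; rewrite -expr2 sqr_ge0. Qed.

Lemma norm2_ge0 f : 0 <= norm2 f.
Proof. exact: sqrtr_ge0. Qed.

Lemma sqr_norm2 f : norm2 f ^+ 2 = dotp f f.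
Proof. by rewrite sqr_sqrtr// dotp_ge0. Qed.

(** The discriminant argument of [ip_le_norm], now for a form that is only semidefinite:
    [dotp g g = 0] is treated through the affine function of [a] that remains. *)
Lemma dotp_le f g : sqint f -> sqint g -> `|dotp f g| <= norm2 f * norm2 g.
Proof.
move=> sf sg.
have key a : 0 <= dotp f f - 2 * a * dotp f g + a ^+ 2 * dotp g g.
  have := dotp_ge0 (f \- (fun x => a * g x)).
  have sag := sqintZ a sg; have sfag := sqintB sf sag.
  rewrite dotpBl// !dotpBr// !dotpZl// !dotpZr// (dotpC g f).
  by move=> h; rewrite (le_trans h)// le_eqVlt; apply/orP; left; apply/eqP; ring.
rewrite -ler_sqr ?nnegrE ?mulr_ge0 ?norm2_ge0// exprMn !sqr_norm2.
rewrite real_normK ?num_real//.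
move: key (dotp_ge0 f) (dotp_ge0 g).
move: (dotp f f) (dotp g g) (dotp f g) => p q c key p0.
rewrite le_eqVlt => /predU1P[q0|q0].
  have [->|c0] := eqVneq c 0; first by rewrite expr0n mulr_ge0// -q0.
  have := key ((p + 1) / (2 * c)); rewrite -q0.
  have -> : 2 * ((p + 1) / (2 * c)) * c = p + 1 by field.
  by move=> h; lra.
have := key (c / q).
have -> : p - 2 * (c / q) * c + (c / q) ^+ 2 * q = (p * q - c ^+ 2) / q.
  by field; rewrite gt_eqF.
by rewrite pmulr_lge0 ?invr_gt0// subr_ge0.
Qed.

Lemma norm2D f g : sqint f -> sqint g -> norm2 (f \+ g) <= norm2 f + norm2 g.
Proof.
move=> sf sg; rewrite -ler_sqr ?nnegrE ?addr_ge0 ?norm2_ge0//.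
rewrite sqrrD !sqr_norm2; have sfg := sqintD sf sg.
rewrite dotpDl// !dotpDr// (dotpC g f).
have := dotp_le sf sg; have := ler_norm (dotp f g); rewrite mulr2n; lra.
Qed.

Lemma norm2Z a f : sqint f -> norm2 (fun x => a * f x) = `|a| * norm2 f.
Proof.
move=> sf; rewrite /norm2 dotpZl ?dotpZr//; last exact: sqintZ.
by rewrite mulrA -expr2 sqrtrM ?sqr_ge0// sqrtr_sqr.
Qed.

Lemma norm2_le f K : 0 <= K ->
  (\int[mu]_(x in D) (f x ^+ 2)%:E <= (K ^+ 2)%:E)%E -> norm2 f <= K.
Proof.
move=> K0 h; rewrite -[leRHS]ger0_norm// -sqrtr_sqr ler_wsqrtr//.
rewrite -lee_fin (le_trans _ h)// /dotp /Rintegral.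
under eq_integral do rewrite -expr2.
rewrite fineK// ge0_fin_numE; first by rewrite (le_lt_trans h)// ltry.
by apply: integral_ge0 => x _; rewrite lee_fin sqr_ge0.
Qed.

Lemma integral_sqr f : sqint f ->
  (\int[mu]_(x in D) (f x ^+ 2)%:E = (norm2 f ^+ 2)%:E)%E.
Proof.
move=> sf; rewrite sqr_norm2 /dotp /Rintegral fineK.
  by under eq_integral do rewrite expr2.
exact: integrable_fin_num (sqintM sf sf).
Qed.

Lemma dotp_ae_eq f1 f2 g1 g2 : sqint f1 -> sqint f2 -> sqint g1 -> sqint g2 ->
  {ae mu, forall x, D x -> f1 x = f2 x} -> {ae mu, forall x, D x -> g1 x = g2 x} ->
  dotp f1 g1 = dotp f2 g2.
Proof.
move=> sf1 sf2 sg1 sg2 f12 g12; rewrite /dotp /Rintegral; congr fine.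
apply: ae_eq_integral => //.
- exact: measurable_int (sqintM sf1 sg1).
- exact: measurable_int (sqintM sf2 sg2).
- by apply: filterS2 f12 g12 => x f12 g12 Dx; rewrite f12// g12.
Qed.

End SquareIntegrable.

(** * Derivative of an expected product *)

(** Ordering the pair as [s < t] with [tau] at either end handles left and right quotients by one
    estimate, and the end points of [[0, T]] along with them. *)
Lemma has_derivative_withinP (R : realType) (T : R) (f : R -> R) (tau l : R) :
    tau \in `[0, T] ->
    (forall e, 0 < e -> exists2 r, 0 < r &
      forall s t, s \in `[0, T] -> t \in `[0, T] -> s < t -> s = tau \/ t = tau ->
      t - s < r -> `|f t - f s - (t - s) * l| <= e * (t - s)) ->
  has_derivative_within `[0, T] f tau l.
Proof.
move=> tauT H; apply/cvgrPdist_le => e e0.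
have [r r0 rP] := H _ e0.
have main s t : s < t -> s \in `[0, T] -> t \in `[0, T] -> s = tau \/ t = tau ->
    t - s < r -> `|l - (f t - f s) / (t - s)| <= e.
  move=> st sT tT ss tsr; have d0 : 0 < t - s by rewrite subr_gt0.
  have -> : l - (f t - f s) / (t - s) = - ((f t - f s - (t - s) * l) / (t - s)).
    by field; rewrite gt_eqF.
  by rewrite normrN normrM normfV (gtr0_norm d0) ler_pdivrMr//; exact: rP.
rewrite near_withinE; apply/nbhs_normP; exists r => //= s; rewrite /ball_/= => dr ns sT.
have [lt|gt|eq] := ltgtP s tau; last by rewrite eq eqxx in ns.
- have -> : (f s - f tau) / (s - tau) = (f tau - f s) / (tau - s).
    by rewrite -(opprB (f tau)) -(opprB tau) invrN mulrNN.
  apply: main => //; first by right.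
  by move: dr; rewrite gtr0_norm ?subr_gt0.
- apply: main => //; first by left.
  by move: dr; rewrite ltr0_norm ?subr_lt0// opprB.
Qed.

Section ProductRule.
Context {d} {Omega : measurableType d} {R : realType}.
Variables (P : {measure set Omega -> \bar R}) (T : R).
Implicit Types (x y a b be ga : R -> Omega -> R).

Local Notation sqint := (sqint P setT).
Local Notation dotp := (dotp P setT).
Local Notation norm2 := (norm2 P setT).

(* The square-integrable process [x] has the stochastic differential
   [a dt + d be] on [0, T]. *)
Record drift_noise x a be : Prop := {
  drift_process : forall t, t \in `[0, T] -> sqint (x t) ;
  drift_drift : forall t, t \in `[0, T] -> sqint (a t) ;
  drift_noise_sqint : forall s t, s \in `[0, T] -> t \in `[0, T] -> s < t ->
    sqint (be t \- be s) ;
  drift_increment : forall tau, tau \in `[0, T] -> forall e, 0 < e ->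
    exists2 r, 0 < r & forall s t, s \in `[0, T] -> t \in `[0, T] -> s < t ->
      `|s - tau| < r -> `|t - tau| < r ->
      norm2 (x t \- x s \- (fun w => (t - s) * a tau w) \- (be t \- be s))
        <= e * (t - s) }.

(** The norm of the increment is [sqrt (c (t - s))]: it tends to 0, but more slowly than [t - s]. *)
Lemma noise_small be c :
    (forall s t, s \in `[0, T] -> t \in `[0, T] -> s < t ->
      dotp (be t \- be s) (be t \- be s) = (t - s) * c) ->
  forall e, 0 < e -> exists2 r, 0 < r & forall s t,
    s \in `[0, T] -> t \in `[0, T] -> s < t -> t - s < r ->
    norm2 (be t \- be s) <= e.
Proof.
move=> bec e e0.
have c0 : 0 < `|c| + 1 by rewrite ltr_wpDl.
exists (e ^+ 2 / (`|c| + 1)); first by rewrite divr_gt0// exprn_gt0.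
move=> s t sT tT st tsr; rewrite -ler_sqr ?nnegrE ?norm2_ge0 ?(ltW e0)//.
rewrite sqr_norm2 bec//.
have d0 : 0 < t - s by rewrite subr_gt0.
move: tsr; rewrite ltr_pdivlMr// => /ltW; apply: le_trans.
by rewrite ler_pM2l// (le_trans (ler_norm _))// lerDl.
Qed.

Lemma norm2_distC f g : norm2 (f \- g) = norm2 (g \- f).
Proof.
rewrite /norm2 /dotp; congr Num.sqrt; apply: eq_Rintegral => w _ /=.
by ring.
Qed.

Let process_small x a be c tau : tau \in `[0, T] -> drift_noise x a be ->
    (forall s t, s \in `[0, T] -> t \in `[0, T] -> s < t ->
      dotp (be t \- be s) (be t \- be s) = (t - s) * c) ->
  forall e, 0 < e -> exists2 r, 0 < r & forall s t,
    s \in `[0, T] -> t \in `[0, T] -> s < t -> `|s - tau| < r -> `|t - tau| < r ->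
    norm2 (x t \- x s) <= e.
Proof.
move=> tauT [xS aS beS xI] bec e e0.
have e3 : 0 < e / 3 by rewrite divr_gt0.
have [r1 r10 r1P] := noise_small bec e3.
have [r2 r20 r2P] := xI _ tauT 1 ltr01.
have N0 : 0 < norm2 (a tau) + 1 by rewrite ltr_wpDl// norm2_ge0.
pose r3 := e / 3 / (norm2 (a tau) + 1).
have r30 : 0 < r3 by rewrite divr_gt0.
(* Both times are within [r] of [tau], so [t - s < 2 r]; hence the halves. The noise, the drift and
   the remainder (at most [t - s]) then take [e / 3] each. *)
pose r := Num.min (r1 / 2) (Num.min r2 (Num.min (r3 / 2) (e / 6))).
have r0 : 0 < r by rewrite !lt_min r20 !divr_gt0.
exists r => // s t sT tT st; rewrite !lt_min.
move=> /and4P[s1 s2 s3 s4] /and4P[t1 t2 t3 t4].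
have h1 : t - s < r1 by move: s1 t1; rewrite !ltr_norml => /andP[? ?] /andP[? ?]; lra.
have h3 : t - s < r3 by move: s3 t3; rewrite !ltr_norml => /andP[? ?] /andP[? ?]; lra.
have h4 : t - s < e / 3 by move: s4 t4; rewrite !ltr_norml => /andP[? ?] /andP[? ?]; lra.
have d0 : 0 < t - s by rewrite subr_gt0.
have := r2P s t sT tT st s2 t2; set D := (X in norm2 X) => DP.
have sra : sqint (fun w => (t - s) * a tau w) by apply: sqintZ => //; exact: aS.
have sb := beS s t sT tT st.
have sx : sqint (x t \- x s) by apply: sqintB => //; exact: xS.
have sD : sqint D by do 2 (apply: sqintB => //).
have -> : x t \- x s = D \+ ((fun w => (t - s) * a tau w) \+ (be t \- be s)).
  by apply/funext => w; rewrite /D/=; ring.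
rewrite (le_trans (norm2D _ _ _))//; first exact: sqintD.
have h5 := norm2D measurableT sra sb.
have h6 := r1P s t sT tT st h1.
have h7 : norm2 (fun w => (t - s) * a tau w) <= e / 3.
  rewrite norm2Z//; last exact: aS.
  move: h3; rewrite /r3 ltr_pdivlMr// => /ltW; apply: le_trans.
  by rewrite gtr0_norm// ler_pM2l// lerDl.
lra.
Qed.

(** Expand [x t y t - x s y s] as [x s dy + dx y s + dx dy]. The noise in the first two terms is
    orthogonal to the past, so they contribute drifts only; in [dx dy] only the product of the
    noises is of first order, and it yields [q]. *)
Lemma product_rule x y a b be ga cb cg q tau :
    tau \in `[0, T] -> drift_noise x a be -> drift_noise y b ga ->
    (forall s t, s \in `[0, T] -> t \in `[0, T] -> s < t ->
      [/\ dotp (be t \- be s) (be t \- be s) = (t - s) * cb,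
          dotp (ga t \- ga s) (ga t \- ga s) = (t - s) * cg,
          dotp (be t \- be s) (ga t \- ga s) = (t - s) * q,
          dotp (x s) (ga t \- ga s) = 0 & dotp (be t \- be s) (y s) = 0]) ->
  has_derivative_within `[0, T] (fun t => dotp (x t) (y t)) tau
    (dotp (x tau) (b tau) + dotp (a tau) (y tau) + q).
Proof.
move=> tauT hx hy hq; apply: has_derivative_withinP => // e e0.
have [xS aS beS xI] := hx; have [yS bS gaS yI] := hy.
have sxtau := xS _ tauT; have sytau := yS _ tauT.
have satau := aS _ tauT; have sbtau := bS _ tauT.
(* The eight error terms below add up to at most [eta * K * (t - s)]. Of the 4, two come from
   bounding [norm2 (x s)] and [norm2 (y s)] by their values at [tau] plus 1, two from products
   [eta * eta], bounded by [eta]. *)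
pose K := norm2 (x tau) + norm2 (y tau) + 2 * norm2 (a tau) + 2 * norm2 (b tau) + 4.
have N0 f : 0 <= norm2 f by exact: norm2_ge0.
have K0 : 0 < K.
  have := N0 (x tau); have := N0 (y tau); have := N0 (a tau); have := N0 (b tau).
  by rewrite /K; lra.
pose eta := Num.min 1 (e / K).
have eta0 : 0 < eta by rewrite lt_min ltr01 divr_gt0.
have eta1 : eta <= 1 by rewrite ge_min lexx.
have etaK : eta * K <= e by rewrite -ler_pdivlMr// ge_min lexx orbT.
have hbe s t : s \in `[0, T] -> t \in `[0, T] -> s < t ->
    dotp (be t \- be s) (be t \- be s) = (t - s) * cb.
  by move=> sT tT st; have [] := hq s t sT tT st.
have hga s t : s \in `[0, T] -> t \in `[0, T] -> s < t ->
    dotp (ga t \- ga s) (ga t \- ga s) = (t - s) * cg.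
  by move=> sT tT st; have [] := hq s t sT tT st.
have [r1 r10 r1P] := process_small tauT hx hbe eta0.
have [r2 r20 r2P] := process_small tauT hy hga eta0.
have [r3 r30 r3P] := noise_small hbe eta0.
have [r5 r50 r5P] := xI _ tauT _ eta0.
have [r6 r60 r6P] := yI _ tauT _ eta0.
exists (Num.min (Num.min r1 r2) (Num.min r3 (Num.min r5 r6))).
  by rewrite !lt_min r10 r20 r30 r50 r60.
move=> s t sT tT st ss.
rewrite !lt_min => /andP[/andP[h1 h2] /and3P[h3 h5 h6]].
have d0 : 0 < t - s by rewrite subr_gt0.
have ds r : t - s < r -> 0 < r -> `|s - tau| < r.
  by case: ss => <- h h0; rewrite ?subrr ?normr0// distrC gtr0_norm.
have dt r : t - s < r -> 0 < r -> `|t - tau| < r.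
  by case: ss => <- h h0; rewrite ?subrr ?normr0// gtr0_norm.
have sxs := xS _ sT; have sxt := xS _ tT; have sys := yS _ sT; have syt := yS _ tT.
have sbe := beS s t sT tT st.
have sga := gaS s t sT tT st.
have sra := sqintZ measurableT (t - s) satau.
have srb := sqintZ measurableT (t - s) sbtau.
have sdx := sqintB measurableT sxt sxs; have sdy := sqintB measurableT syt sys.
have ndx := r1P s t sT tT st (ds _ h1 r10) (dt _ h1 r10).
have ndy := r2P s t sT tT st (ds _ h2 r20) (dt _ h2 r20).
have nbe := r3P s t sT tT st h3.
have := r5P s t sT tT st (ds _ h5 r50) (dt _ h5 r50).
have := r6P s t sT tT st (ds _ h6 r60) (dt _ h6 r60).
set Dy := (X in norm2 X <= _ -> _) => nDy; set Dx := (X in norm2 X <= _) => nDx.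
have sDx : sqint Dx by apply: sqintB => //; exact: sqintB.
have sDy : sqint Dy by apply: sqintB => //; exact: sqintB.
have [_ _ hbg hxg hby] := hq s t sT tT st.
have eqs f z : f = z -> norm2 (f \- z) = 0.
  move=> ->; rewrite /norm2 /dotp (@eq_Rintegral _ _ _ P setT (fun=> 0)).
    by rewrite Rintegral_cst// mul0r sqrtr0.
  by move=> w _ /=; rewrite subrr mul0r.
have nxs : norm2 (x s \- x tau) <= eta.
  by case: ss => <-; [rewrite eqs// ltW|rewrite norm2_distC].
have nys : norm2 (y s \- y tau) <= eta.
  by case: ss => <-; [rewrite eqs// ltW|rewrite norm2_distC].
have sdxs := sqintB measurableT sxs sxtau; have sdys := sqintB measurableT sys sytau.
have Nxs : norm2 (x s) <= norm2 (x tau) + 1.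
  have -> : x s = (x s \- x tau) \+ x tau by apply/funext => w /=; rewrite subrK.
  by rewrite (le_trans (norm2D _ _ _))// addrC lerD2l (le_trans nxs).
have Nys : norm2 (y s) <= norm2 (y tau) + 1.
  have -> : y s = (y s \- y tau) \+ y tau by apply/funext => w /=; rewrite subrK.
  by rewrite (le_trans (norm2D _ _ _))// addrC lerD2l (le_trans nys).
have bound f g u v : sqint f -> sqint g -> norm2 f <= u -> norm2 g <= v ->
    `|dotp f g| <= u * v.
  by move=> sf sg fu gv; rewrite (le_trans (dotp_le _ sf sg))// ler_pM.
have b1 := bound _ _ _ _ sxs sDy Nxs nDy.
have b2 := bound _ _ _ _ sDx sys nDx Nys.
have b3 := bound _ _ _ _ sDx sdy nDx ndy.
have b4 := bound _ _ _ _ satau sdy (lexx _) ndy.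
have b5 := bound _ _ _ _ sbe sDy nbe nDy.
have b6 := bound _ _ _ _ sbe sbtau nbe (lexx _).
have b7 := bound _ _ _ _ sdxs sbtau nxs (lexx _).
have b8 := bound _ _ _ _ satau sdys (lexx _) nys.
set r := t - s in d0 *.
(* An exact identity: [dx] is expanded everywhere, but in [dx dy] the factor [dy] is expanded only
   against the noise of [x]. The last two terms in the factor of [r] replace values at [s] by values
   at [tau]. *)
have -> : dotp (x t) (y t) - dotp (x s) (y s)
    - r * (dotp (x tau) (b tau) + dotp (a tau) (y tau) + q) =
  (dotp (x s) Dy + dotp Dx (y s) + dotp Dx (y t \- y s) + dotp (be t \- be s) Dy)
  + r * (dotp (a tau) (y t \- y s) + dotp (be t \- be s) (b tau)
         + dotp (x s \- x tau) (b tau) + dotp (a tau) (y s \- y tau)).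
  have sDx1 := sqintB measurableT sdx sra; have sDy1 := sqintB measurableT sdy srb.
  have e1 : dotp (x s) Dy = dotp (x s) (y t) - dotp (x s) (y s) - r * dotp (x s) (b tau).
    by rewrite dotpBr// hxg subr0 dotpBr// dotpBr// dotpZr.
  have e2 : dotp Dx (y s) = dotp (x t) (y s) - dotp (x s) (y s) - r * dotp (a tau) (y s).
    by rewrite dotpBl// hby subr0 dotpBl // dotpBl// dotpZl.
  have e3 : dotp Dx (y t \- y s) = dotp (x t \- x s) (y t \- y s)
      - r * dotp (a tau) (y t \- y s) - dotp (be t \- be s) (y t \- y s).
    by rewrite [dotp Dx _]dotpBl// [dotp (_ \- _ \- _) _]dotpBl// dotpZl.
  have e4 : dotp (be t \- be s) Dy =
      dotp (be t \- be s) (y t \- y s) - r * dotp (be t \- be s) (b tau) - r * q.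
    by rewrite [dotp _ Dy]dotpBr// hbg [dotp _ (_ \- _ \- _)]dotpBr// dotpZr.
  have e5 : dotp (x t \- x s) (y t \- y s) =
      dotp (x t) (y t) - dotp (x t) (y s) - (dotp (x s) (y t) - dotp (x s) (y s)).
    by rewrite dotpBl// !dotpBr.
  have e6 : dotp (x s \- x tau) (b tau) = dotp (x s) (b tau) - dotp (x tau) (b tau).
    by rewrite dotpBl.
  have e7 : dotp (a tau) (y s \- y tau) = dotp (a tau) (y s) - dotp (a tau) (y tau).
    by rewrite dotpBr.
  by rewrite e1 e2 e3 e4 e5 e6 e7; ring.
set X1 := dotp _ _ in b1 *; set X2 := dotp _ _ in b2 *; set X3 := dotp _ _ in b3 *.
set X5 := dotp _ _ in b5 *; set X4 := dotp _ _ in b4 *; set X6 := dotp _ _ in b6 *.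
set X7 := dotp _ _ in b7 *; set X8 := dotp _ _ in b8 *.
rewrite -[t - s]/r in b1 b2 b3 b5.
apply: (@le_trans _ _ ((`|X1| + `|X2| + `|X3| + `|X5|) + r * (`|X4| + `|X6| + `|X7| + `|X8|))).
  rewrite (le_trans (ler_normD _ _))// lerD//.
    by do 3 (rewrite (le_trans (ler_normD _ _))// lerD2r).
  rewrite normrM gtr0_norm// ler_pM2l//.
  by do 3 (rewrite (le_trans (ler_normD _ _))// lerD2r).
have rr : eta * (eta * r) <= 1 * (eta * r) by rewrite ler_pM2r// mulr_gt0.
have rr' : eta * r * eta <= eta * r by rewrite -[leRHS]mulr1 ler_pM2l// mulr_gt0.
apply: (@le_trans _ _ (eta * K * r)); last by rewrite ler_pM2r.
have hr : r * (`|X4| + `|X6| + `|X7| + `|X8|) <=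
    r * (norm2 (a tau) * eta + eta * norm2 (b tau) + eta * norm2 (b tau) + norm2 (a tau) * eta).
  by rewrite ler_pM2l// !lerD.
by rewrite /K; lra.
Qed.

End ProductRule.

(** * Independence *)

Section Law.
Context {d} {Omega : measurableType d} {R : realType}.
Variable P : probability Omega R.
Implicit Types Y Z : Omega -> R.

Lemma normal_law_sqr Z s : 0 < s -> measurable_fun setT Z ->
  has_law P Z (normal_prob 0 s) -> (\int[P]_w (Z w ^+ 2)%:E = (s ^+ 2)%:E)%E.
Proof.
move=> s0 mZ lawZ.
pose Z' : {mfun Omega >-> measurableTypeR R} :=
  HB.pack Z (isMeasurableFun.Build _ _ _ (measurableTypeR R) _ mZ).
rewrite -(normal_prob_second_moment s0).
transitivity (\int[distribution P Z']_y (y ^+ 2)%:E)%E; last first.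
  by apply: eq_measure_integral => B mB _; exact: lawZ.
rewrite ge0_integral_distribution//.
- by apply/measurable_EFinP; exact: measurable_funX.
- by move=> y; rewrite lee_fin sqr_ge0.
Qed.

Lemma eq_law_integral Y Z (mu : set R -> \bar R) :
  P.-integrable setT (EFin \o Y) -> P.-integrable setT (EFin \o Z) ->
  has_law P Y mu -> has_law P Z mu ->
  (\int[P]_w (Y w)%:E = \int[P]_w (Z w)%:E)%E.
Proof.
move=> iY iZ lY lZ.
have mY : measurable_fun setT Y by apply/measurable_EFinP; exact: measurable_int iY.
have mZ : measurable_fun setT Z by apply/measurable_EFinP; exact: measurable_int iZ.
pose Y' : {mfun Omega >-> R} := HB.pack Y (isMeasurableFun.Build _ _ _ _ _ mY).
pose Z' : {mfun Omega >-> R} := HB.pack Z (isMeasurableFun.Build _ _ _ _ _ mZ).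
have mE : measurable_fun [set: R] (@EFin R) by apply/measurable_EFinP.
rewrite -[LHS](@integral_distribution _ _ _ _ _ P Y' (@EFin R))//.
rewrite -[RHS](@integral_distribution _ _ _ _ _ P Z' (@EFin R))//.
by apply: eq_measure_integral => B mB _; rewrite -[LHS]/(P (Y @^-1` B)) lY// -lZ.
Qed.

(** Independence makes the joint law of [(Y, Z)] agree with the product of the laws on rectangles,
    hence everywhere. Fubini then integrates [Z] first, which gives 0. *)
Lemma dotp_independent (G : set (set Omega)) Y Z :
  sqint P setT Y -> sqint P setT Z ->
  (forall B : set R, measurable B -> G (Y @^-1` B)) ->
  independent_of P G Z -> (\int[P]_w (Z w)%:E = 0)%E ->
  P.-integrable setT (EFin \o Z) ->
  dotp P setT Y Z = 0.
Proof.
move=> sY sZ GY GZ Z0 iZ.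
have [mY _] := sY; have [mZ _] := sZ.
pose Y' : {mfun Omega >-> R} := HB.pack Y (isMeasurableFun.Build _ _ _ _ _ mY).
pose Z' : {mfun Omega >-> R} := HB.pack Z (isMeasurableFun.Build _ _ _ _ _ mZ).
have mYZ : measurable_fun setT (fun w => (Y w, Z w)) by exact: measurable_fun_pair.
pose YZ : {mfun Omega >-> (R * R)%type} :=
  HB.pack (fun w => (Y w, Z w)) (isMeasurableFun.Build _ _ _ _ _ mYZ).
pose f (p : R * R) := (p.1 * p.2)%:E.
have mf : measurable_fun [set: R * R] f.
  by apply/measurable_EFinP; apply: measurable_funM.
have prodE (X : set (R * R)) : measurable X ->
    (distribution P Y' \x distribution P Z')%E X = distribution P YZ X.
  apply: product_measure_unique => A B mA mB.
  rewrite -[LHS]/(P (Y @^-1` A `&` Z @^-1` B)) GZ//.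
  exact: GY.
have iYZ : P.-integrable setT (f \o YZ) by exact: sqintM.
have ip : (distribution P YZ).-integrable setT f by exact: integrable_pushforward.
have ipp : (distribution P Y' \x distribution P Z')%E.-integrable setT f.
  apply/integrableP; split => //; move/integrableP : ip => [_]; apply: le_lt_trans.
  rewrite (@eq_measure_integral _ _ _ setT (distribution P YZ))// => X mX _.
  exact: prodE.
rewrite /dotp /Rintegral -[X in fine X](integral_distribution mf iYZ).
rewrite (@eq_measure_integral _ _ _ setT (distribution P Y' \x distribution P Z')%E); last first.
  by move=> X mX _; apply: esym; exact: prodE.
rewrite -integral12_prod_meas1//.
rewrite (eq_integral (cst 0%E)) ?integral0// => y _.
rewrite /fubini_F/= /f/=; under eq_integral do rewrite EFinM.
have mE : measurable_fun [set: R] (@EFin R) by apply/measurable_EFinP.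
have iE : (distribution P Z').-integrable setT (@EFin R) by exact: integrable_pushforward.
by rewrite integralZl// (@integral_distribution _ _ _ _ _ P Z' (@EFin R) mE iZ) Z0 mule0.
Qed.

End Law.

(** * Noise increments *)

Section Noise.
Context {R : realType} {H : completeNormedModType R} (ip : {dot H for idfun}).
Hypothesis hip : induces_norm ip.
Context {d : measure_display} {Omega : measurableType d}.
Variables (P : probability Omega R) (T : R) (F : R -> set (set Omega)).
Hypothesis hF : filtration T F.
Variable W : R -> H -> Omega -> R.
Hypothesis hW : cylindrical_wiener P T F W.
Implicit Types (h k : H) (be ga : R -> Omega -> R).

Local Notation sqint := (sqint P setT).
Local Notation dotp := (dotp P setT).

(* For [|h| <> 1] nothing says that [W t h] is measurable; [be] is a measurable
   version of it. *)
Record wiener_version h be : Prop := {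
  version_ae : forall t, t \in `[0, T] -> {ae P, forall w, W t h w = be t w} ;
  version_sqint : forall s t, s \in `[0, T] -> t \in `[0, T] -> s < t ->
    sqint (be t \- be s) ;
  version_sqr : forall s t, s \in `[0, T] -> t \in `[0, T] -> s < t ->
    dotp (be t \- be s) (be t \- be s) = (t - s) * `|h| ^+ 2 ;
  version_orthogonal : forall s t, s \in `[0, T] -> t \in `[0, T] -> s < t ->
    forall Y, sqint Y -> (forall B : set R, measurable B -> F s (Y @^-1` B)) ->
    dotp Y (be t \- be s) = 0 }.

Let Py : (P setT < +oo)%E.
Proof. by rewrite probability_setT ltry. Qed.

Let wiener0 t : t \in `[0, T] -> {ae P, forall w, W t 0 w = 0}.
Proof.
move=> tT; have := wiener_linear hW tT (-1) 0 0.
rewrite scaler0 addr0; apply: filterS => w ->.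
by rewrite mulN1r addNr.
Qed.

Let wienerZ t a h : t \in `[0, T] -> {ae P, forall w, W t (a *: h) w = a * W t h w}.
Proof.
move=> tT; have := wiener_linear hW tT a h 0; have := wiener0 tT.
by apply: filterS2 => w w0; rewrite addr0 w0 addr0.
Qed.

Section Unit.
Variables (e : H) (s t : R).
Hypotheses (e1 : `|e| = 1) (sT : s \in `[0, T]) (tT : t \in `[0, T]) (st : s < t).

Let s0 : 0 <= s. Proof. by move: sT; rewrite in_itv/= => /andP[]. Qed.
Let tT' : t <= T. Proof. by move: tT; rewrite in_itv/= => /andP[]. Qed.

Let wiener_measurable e' r : `|e'| = 1 -> r \in `[0, T] -> measurable_fun setT (W r e').
Proof.
move=> e'1 rT _ B mB; rewrite setTI.
apply: (filtration_sub hF rT); exact: (brownian_adapted (wiener_brownian hW e'1) rT).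
Qed.

Let wiener_sqr e' : `|e'| = 1 ->
  (\int[P]_w ((W t e' \- W s e') w ^+ 2)%:E = (t - s)%:E)%E.
Proof.
move=> e'1.
have d0 : 0 < t - s by rewrite subr_gt0.
rewrite (@normal_law_sqr _ _ _ _ _ (Num.sqrt (t - s))).
- by rewrite sqr_sqrtr// ltW.
- by rewrite sqrtr_gt0.
- by apply: measurable_funB; exact: wiener_measurable.
- exact: (brownian_law (wiener_brownian hW e'1)).
Qed.

Let wiener_sqint e' : `|e'| = 1 -> sqint (W t e' \- W s e').
Proof.
move=> e'1; apply: sqintP; last by rewrite wiener_sqr// ltry.
by apply: measurable_funB; exact: wiener_measurable.
Qed.

(* [- (W t e - W s e)] is a version of [W t (- e) - W s (- e)], which has the
   same law as [W t e - W s e]. *)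
Let wiener_mean : (\int[P]_w ((W t e \- W s e) w)%:E = 0)%E.
Proof.
have Ne1 : `|- e| = 1 by rewrite normrN.
have sW := wiener_sqint e1; have sNW := wiener_sqint Ne1.
have iW := sqint_integrable measurableT Py sW; have iNW := sqint_integrable measurableT Py sNW.
have E1 : (\int[P]_w ((W t e \- W s e) w)%:E =
    \int[P]_w ((W t (- e) \- W s (- e)) w)%:E)%E.
  apply: (eq_law_integral iW iNW (mu := normal_prob 0 (Num.sqrt (t - s)))).
  - exact: (brownian_law (wiener_brownian hW e1)).
  - exact: (brownian_law (wiener_brownian hW Ne1)).
have E2 : (\int[P]_w ((W t (- e) \- W s (- e)) w)%:E =
    \int[P]_w ((-1)%:E * ((W t e \- W s e) w)%:E))%E.
  apply: ae_eq_integral => //.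
  - exact: measurable_int iNW.
  - exact: measurable_int (integrableZl measurableT (-1) iW).
  - have := wienerZ (-1) e sT; have := wienerZ (-1) e tT.
    apply: filterS2 => w; rewrite scaleN1r => ht hs _ /=.
    by rewrite ht hs -EFinM; congr EFin; ring.
move: E1; rewrite E2 integralZl// => E1.
have := integrable_fin_num measurableT iW.
move: E1; rewrite /comp; case: integral => [r||]//.
by rewrite -EFinM => -[] h _; congr EFin; lra.
Qed.

Lemma wiener_unit :
  [/\ sqint (W t e \- W s e),
      dotp (W t e \- W s e) (W t e \- W s e) = t - s &
      forall Y, sqint Y -> (forall B : set R, measurable B -> F s (Y @^-1` B)) ->
      dotp Y (W t e \- W s e) = 0].
Proof.
have sW := wiener_sqint e1; split => //.
- apply: EFin_inj; rewrite -sqr_norm2 -integral_sqr// wiener_sqr//.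
- move=> Y sY YF; apply: dotp_independent sY sW YF _ wiener_mean (sqint_integrable measurableT Py sW).
  exact: (brownian_indep (wiener_brownian hW e1)).
Qed.

End Unit.

(** For nonzero [h] the version is [|h|] times the Brownian motion in the unit direction [h / |h|],
    equal to [W t h] almost surely by linearity; for [h = 0] it is 0. *)
Lemma wiener_version_exists h : exists be, wiener_version h be.
Proof.
have [->|h0] := eqVneq h 0.
  exists (fun _ _ => 0).
  have e0 : (fun=> 0) \- (fun=> 0) = (fun=> 0 * 0) :> (Omega -> R).
    by apply/funext => w /=; rewrite subrr mulr0.
  have s00 := sqint_cst measurableT 0 Py.
  split=> //.
  - by move=> s t _ _ _; rewrite e0; exact: sqintZ.
  - by move=> s t _ _ _; rewrite e0 dotpZl ?mul0r ?normr0 ?expr0n ?mulr0//; exact: sqintZ.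
  - by move=> s t _ _ _ Y sY _; rewrite e0 dotpZr// mul0r.
have n0 : `|h| != 0 by rewrite normr_eq0.
pose e := `|h|^-1 *: h.
have e1 : `|e| = 1 by rewrite normrZ normfV normr_id mulVf.
exists (fun t w => `|h| * W t e w).
have eE s t : (fun w => `|h| * W t e w) \- (fun w => `|h| * W s e w) =
    (fun w => `|h| * (W t e \- W s e) w).
  by apply/funext => w /=; rewrite mulrBr.
split.
- move=> t tT; have := wienerZ `|h| e tT.
  by rewrite scalerA divff// scale1r.
- by move=> s t sT tT st; rewrite eE; apply: sqintZ => //; have [] := wiener_unit e1 sT tT st.
- move=> s t sT tT st; have [sW dW _] := wiener_unit e1 sT tT st.
  rewrite eE dotpZl ?dotpZr ?dW//; last exact: sqintZ.
  by rewrite mulrA mulrC.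
- move=> s t sT tT st Y sY YF; have [sW _ dW] := wiener_unit e1 sT tT st.
  by rewrite eE dotpZr// dW// mulr0.
Qed.

(** Polarization: a version for [h + k] is almost surely [be + ga] at each time, and its increments
    have variance [(t - s) |h + k|^2]. *)
Lemma wiener_version_covariance h k be ga : wiener_version h be ->
  wiener_version k ga -> forall s t, s \in `[0, T] -> t \in `[0, T] -> s < t ->
  dotp (be t \- be s) (ga t \- ga s) = (t - s) * ip h k.
Proof.
move=> [beW sbe dbe _] [gaW sga dga _] s t sT tT st.
have [ro [roW sro dro _]] := wiener_version_exists (h + k).
have sb := sbe s t sT tT st; have sg := sga s t sT tT st.
have sr := sro s t sT tT st; have sbg := sqintD measurableT sb sg.
have ae r : r \in `[0, T] -> {ae P, forall w, ro r w = be r w + ga r w}.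
  move=> rT; have := wiener_linear hW rT 1 h k.
  rewrite scale1r => lin.
  apply: filterS3 lin (roW r rT) (filterI (beW r rT) (gaW r rT)) => w.
  by move=> e1 e2 [e3 e4]; rewrite -e2 e1 e3 e4 mul1r.
have aeD : {ae P, forall w, setT w ->
    (ro t \- ro s) w = ((be t \- be s) \+ (ga t \- ga s)) w}.
  apply: filterS2 (ae t tT) (ae s sT) => w e1 e2 _ /=.
  by rewrite e1 e2; ring.
have := dotp_ae_eq measurableT sr sbg sr sbg aeD aeD.
rewrite dro// (dotpDl measurableT sb sg sbg) (dotpDr measurableT sb sb sg).
rewrite (dotpDr measurableT sg sb sg) dbe// dga// (dotpC _ _ (ga t \- ga s)).
rewrite -hip -[in X in _ = X -> _]hip -[in X in _ = X -> _](hip k).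
rewrite !(ipDl, ipDr) (ipC ip k h).
by move=> e; lra.
Qed.

End Noise.

(** * Time integrals *)

Section TimeIntegral.
Context {d} {Omega : measurableType d} {R : realType}.
Variables (P : probability Omega R) (s t : R).
Hypothesis st : s < t.
Variable g : measurableTypeR R -> Omega -> R.
Hypothesis mg : measurable_fun ((`[s, t] : set (measurableTypeR R)) `*` setT)
  (fun p : measurableTypeR R * Omega => g p.1 p.2).
Variable K : R.
Hypothesis K0 : 0 <= K.
Hypothesis gK : forall u, u \in `[s, t] ->
  (\int[P]_w (g u w ^+ 2)%:E <= (K ^+ 2)%:E)%E.
Local Notation mu := (@lebesgue_measure R).

Let D : set (measurableTypeR R * Omega) := `[s, t] `*` setT.

Let mst : measurable (`[s, t] : set (measurableTypeR R)).
Proof. exact: measurable_itv. Qed.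

Let mD : measurable D.
Proof. by apply: measurableX. Qed.

(** Extension by 0 makes [g] measurable on the whole product, where Tonelli applies. *)
Let G : measurableTypeR R * Omega -> R := (fun p => g p.1 p.2) \_ D.

Let mG : measurable_fun setT G.
Proof. by apply: (measurable_restrictT _ mD).1. Qed.

Let GE w u : u \in `[s, t] -> G (u, w) = g u w.
Proof. by move=> ust; rewrite /G patchE mem_set. Qed.

Let G0 w u : u \notin `[s, t] -> G (u, w) = 0.
Proof. by move=> /negP ust; rewrite /G patchE memNset//= => -[]. Qed.

Let G2 (p : measurableTypeR R * Omega) : \bar R := (G p ^+ 2)%:E.

Let mG2 : measurable_fun setT G2.
Proof. by apply/measurable_EFinP; exact: measurable_funX. Qed.

Let G2_ge0 p : (0 <= G2 p)%E.
Proof. by rewrite lee_fin sqr_ge0. Qed.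

Let energy w : \bar R := (\int[mu]_(u in `[s, t]) (g u w ^+ 2)%:E)%E.

Let energyE w : energy w = (\int[mu]_u G2 (u, w))%E.
Proof.
rewrite /energy integral_mkcond; apply: eq_integral => u _.
rewrite patchE /G2; case: ifPn => [|].
  by rewrite inE /= => ust; rewrite GE.
by rewrite notin_setE /= => /negP ust; rewrite G0// expr0n.
Qed.

Let menergy : measurable_fun setT energy.
Proof.
rewrite (_ : energy = fubini_G mu G2); last first.
  by apply/funext => w; rewrite energyE.
exact: measurable_fun_fubini_tonelli_G.
Qed.

Let energy_ge0 w : (0 <= energy w)%E.
Proof. by apply: integral_ge0 => u _; rewrite lee_fin sqr_ge0. Qed.

Let mu_st : mu `[s, t] = (t - s)%:E.
Proof. by rewrite lebesgue_measure_itv/= lte_fin st. Qed.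

(** Tonelli turns the bound at each time into a bound on the mean energy of a path, so almost every
    path is square integrable. *)
Let expected_energy : (\int[P]_w energy w <= (K ^+ 2 * (t - s))%:E)%E.
Proof.
under eq_integral do rewrite energyE.
rewrite -(fubini_tonelli G2)//.
rewrite EFinM -mu_st -integral_cst// [leRHS]integral_mkcond.
apply: ge0_le_integral => //.
- by move=> u _; exact: integral_ge0.
- exact: measurable_fun_fubini_tonelli_F.
- by apply: (measurable_restrictT _ mst).1 => //.
- move=> u _; rewrite patchE; case: ifPn => [|].
    rewrite inE /= => ust; rewrite (le_trans _ (gK ust))// le_eqVlt.
    by apply/orP; left; apply/eqP; apply: eq_integral => w _; rewrite /G2 GE.
  rewrite notin_setE /= => /negP ust; rewrite integral0_eq// => w _.
  by rewrite /G2 G0// expr0n.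
Qed.

Let path_measurable w : measurable_fun `[s, t] (fun u : measurableTypeR R => g u w).
Proof.
apply: (@eq_measurable_fun _ _ _ _ `[s, t] (fun u => G (u, w))).
  by move=> u; rewrite inE /= => ust; rewrite GE.
apply: measurable_funTS.
by apply: (@measurableT_comp _ _ _ _ _ _ G) => //; exact: pair2_measurable.
Qed.

Let ae_path_sqint :
  {ae P, forall w, sqint mu `[s, t] (fun u => g u w)}.
Proof.
have ien : P.-integrable setT energy.
  apply/integrableP; split => //.
  under eq_integral do rewrite gee0_abs//.
  by rewrite (le_lt_trans expected_energy)// ltry.
apply: filterS (integrable_ae measurableT ien) => w /(_ I).
rewrite ge0_fin_numE// => wy; apply: sqintP => //.
exact: path_measurable.
Qed.

Let mu_sty : (mu `[s, t] < +oo)%E.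
Proof. by rewrite mu_st ltry. Qed.

Lemma ae_path_integrable :
  {ae P, forall w, mu.-integrable `[s, t] (EFin \o (g ^~ w))}.
Proof.
apply: filterS ae_path_sqint => w sg.
exact: (sqint_integrable mst mu_sty sg).
Qed.

(* Cauchy-Schwarz along each path, then Tonelli. *)
Lemma time_integral_norm2 Z : measurable_fun setT Z ->
  {ae P, forall w, Z w = \int[mu]_(u in `[s, t]) g u w} ->
  sqint P setT Z /\ norm2 P setT Z <= K * (t - s).
Proof.
move=> mZ ZE.
have d0 : 0 < t - s by rewrite subr_gt0.
have main : (\int[P]_w (Z w ^+ 2)%:E <= ((K * (t - s)) ^+ 2)%:E)%E.
  apply: (@le_trans _ _ (\int[P]_w ((t - s)%:E * energy w))%E).
    apply: ae_ge0_le_integral => //.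
    - by move=> w _; rewrite lee_fin sqr_ge0.
    - by apply/measurable_EFinP; exact: measurable_funX.
    - by move=> w _; rewrite mule_ge0// lee_fin ltW.
    - exact: measurable_funeM.
    - apply: filterS2 ZE ae_path_sqint => w Zw sg _.
      have := dotp_le mst sg (sqint_cst mst 1 mu_sty).
      have -> : dotp mu `[s, t] (fun u => g u w) (fun=> 1) =
          \int[mu]_(u in `[s, t]) g u w.
        by apply: eq_Rintegral => u _; rewrite mulr1.
      rewrite -Zw => h.
      rewrite /energy (integral_sqr mst sg) -EFinM lee_fin.
      have n1 : norm2 mu `[s, t] (fun=> 1) ^+ 2 = t - s.
        by rewrite sqr_norm2 /dotp mulr1 Rintegral_cst// mul1r /= lebesgue_measure_itv/= lte_fin st.
      rewrite -{1}n1 mulrC -exprMn -real_normK ?num_real//.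
      by rewrite ler_sqr ?nnegrE// mulr_ge0 ?norm2_ge0.
  rewrite ge0_integralZl// ?lee_fin ?(ltW d0)//.
  apply: (le_trans (lee_wpmul2l _ expected_energy)); first by rewrite lee_fin ltW.
  rewrite -EFinM lee_fin le_eqVlt; apply/orP; left; apply/eqP; ring.
split; last by apply: norm2_le => //; rewrite mulr_ge0// ltW.
by apply: sqintP => //; rewrite (le_lt_trans main)// ltry.
Qed.

End TimeIntegral.

(** * Weak solutions *)

Lemma continuous_borel (R : realType) (H : completeNormedModType R) (f : H -> R) :
  continuous f -> forall B : set R, measurable B -> <<s @open H >> (f @^-1` B).
Proof.
move=> cf B mB.
have mf : @measurable_fun _ _ (g_sigma_algebraType (@open H)) R setT f.
  apply: (measurability _ (RGenOpens.measurableE R)).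
  move=> _ [_ [a [b ->] <-]]; rewrite setTI; apply: sub_sigma_algebra.
  by apply: open_comp => //; exact: interval_open.
by have := mf measurableT B mB; rewrite setTI.
Qed.

Section WeakSolution.
Context {R : realType} {H : completeNormedModType R} (ip : {dot H for idfun}).
Hypothesis hip : induces_norm ip.
Context {d : measure_display} {Omega : measurableType d}.
Variables (P : probability Omega R) (T : R).
Variable F : R -> set (set Omega).
Hypothesis hF : filtration T F.
Variable W : R -> H -> Omega -> R.
Hypothesis hW : cylindrical_wiener P T F W.
Variables (A : operator H) (S : H -> H) (X : R -> Omega -> H).
Hypothesis hX : weak_solution ip P T F W A S X.
Hypothesis dense_dom : forall eta e, 0 < e ->
  exists2 phi, dom (adjoint ip A) phi & `|eta - phi| < e.
Implicit Types (phi psi eta : H) (be : R -> Omega -> R).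

Local Notation sqint := (sqint P setT).
Local Notation dotp := (dotp P setT).
Local Notation norm2 := (norm2 P setT).
Local Notation mu := (@lebesgue_measure R).

Let Py : (P setT < +oo)%E.
Proof. by rewrite probability_setT ltry. Qed.

Definition coord phi (t : R) (w : Omega) := ip (X t w) phi.

Lemma coord_adapted phi t : t \in `[0, T] ->
  forall B : set R, measurable B -> F t (coord phi t @^-1` B).
Proof.
move=> tT B mB.
exact: (solution_adapted hX tT (continuous_borel (@continuous_ipl _ _ _ hip phi) mB)).
Qed.

Let coord_measurable phi t : t \in `[0, T] -> measurable_fun setT (coord phi t).
Proof.
move=> tT _ B mB; rewrite setTI; apply: (filtration_sub hF tT).
exact: coord_adapted.
Qed.

Let coord_joint phi (s t : R) : 0 <= s -> t <= T ->
  measurable_fun ((`[s, t] : set (measurableTypeR R)) `*` setT)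
    (fun p : measurableTypeR R * Omega => coord phi p.1 p.2).
Proof.
move=> s0 tT.
have mf : @measurable_fun _ _ (g_sigma_algebraType (@open H)) R setT (fun x => ip x phi).
  move=> _ B mB; rewrite setTI.
  exact: (continuous_borel (@continuous_ipl _ _ _ hip phi)).
have h : measurable_fun ((`[0, T] : set (measurableTypeR R)) `*` setT)
    (fun p : measurableTypeR R * Omega => coord phi p.1 p.2).
  exact: (measurableT_comp mf (solution_measurable hX)).
apply: measurable_funS h; first by apply: measurableX => //; exact: measurable_itv.
by apply: setSX => // u /=; rewrite !in_itv/= => /andP[su ut]; lra.
Qed.

(** Cauchy-Schwarz in [H]. One [N] serves all [phi] and [t], so approximating [phi] approximates its
    coordinate uniformly in time. *)
Lemma second_moment : exists2 N, 0 <= N & forall phi t, t \in `[0, T] ->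
  (\int[P]_w (coord phi t w ^+ 2)%:E <= ((N * `|phi|) ^+ 2)%:E)%E.
Proof.
have [M MP] := solution_moments hX.
exists (Num.sqrt M) => [|phi t tT]; first exact: sqrtr_ge0.
have mX2 : measurable_fun setT (fun w => `|X t w| ^+ 2).
  move=> _ B mB; rewrite setTI; apply: (filtration_sub hF tT).
  have cn : continuous (fun x : H => `|x| ^+ 2); last first.
    exact: (solution_adapted hX tT (continuous_borel cn mB)).
  move=> x; apply: (@continuous_comp _ _ _ (fun x : H => `|x|) (fun r : R => r ^+ 2)).
    exact: norm_continuous.
  exact: exprn_continuous.
have M0 : 0 <= M.
  rewrite -lee_fin (le_trans _ (MP t tT))//.
  by apply: integral_ge0 => w _; rewrite lee_fin sqr_ge0.
rewrite exprMn sqr_sqrtr// mulrC EFinM.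
apply: (@le_trans _ _ (\int[P]_w ((`|phi| ^+ 2)%:E * (`|X t w| ^+ 2)%:E))%E).
  apply: ge0_le_integral => //.
  - by move=> w _; rewrite lee_fin sqr_ge0.
  - by apply/measurable_EFinP/measurable_funX; exact: coord_measurable.
  - by apply: measurable_funeM; apply/measurable_EFinP.
  - move=> w _; rewrite -EFinM lee_fin mulrC -exprMn -real_normK ?num_real//.
    by rewrite ler_sqr ?nnegrE ?mulr_ge0//; exact: ip_le_norm.
rewrite ge0_integralZl//.
- by rewrite lee_wpmul2l ?lee_fin ?sqr_ge0//; exact: MP.
- by apply/measurable_EFinP.
Qed.

Lemma coord_sqint phi t : t \in `[0, T] -> sqint (coord phi t).
Proof.
move=> tT; have [N _ NP] := second_moment.
apply: sqintP => //; first exact: coord_measurable.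
by rewrite (le_lt_trans (NP phi t tT))// ltry.
Qed.

Section Increments.
Variables (phi : H) (be : R -> Omega -> R).
Hypothesis dphi : dom (adjoint ip A) phi.
Hypothesis hbe : wiener_version P T F W (adjoint ip (total_op S) phi) be.
Local Notation a := (coord (adjoint ip A phi)).

Let bounds s t : s \in `[0, T] -> t \in `[0, T] -> 0 <= s /\ t <= T.
Proof. by rewrite !in_itv/= => /andP[? _] /andP[_ ?]. Qed.

Let sub_itv s t u : s \in `[0, T] -> t \in `[0, T] -> u \in `[s, t] -> u \in `[0, T].
Proof. by rewrite !in_itv/= => /andP[? ?] /andP[? ?] /andP[? ?]; lra. Qed.

(** The weak equation at [t] minus that at [s], with [W] replaced by its version. Subtracting the
    time integrals requires the path to be integrable on [[0, t]], which the moment bound ensures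
    almost surely. *)
Lemma increment_ae s t : s \in `[0, T] -> t \in `[0, T] -> s < t ->
  {ae P, forall w, mu.-integrable `[s, t] (EFin \o (a ^~ w)) /\
    (coord phi t \- coord phi s \- (be t \- be s)) w =
    \int[mu]_(u in `[s, t]) a u w}.
Proof.
move=> sT tT st; have [s0 t1] := bounds sT tT.
have t0 : 0 < t := le_lt_trans s0 st.
have zT : 0 \in `[0, T] by rewrite in_itv/= lexx (le_trans (ltW t0)).
have [N N0 NP] := second_moment.
have aeg := ae_path_integrable t0 (coord_joint (adjoint ip A phi) (lexx 0) t1)
  (fun u ut => NP (adjoint ip A phi) u (sub_itv zT tT ut)).
have ae_x : {ae P, forall w, coord phi t w - coord phi s w =
    \int[mu]_(u in `[0, t]) a u w - \int[mu]_(u in `[0, s]) a u w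
    + (W t (adjoint ip (total_op S) phi) w - W s (adjoint ip (total_op S) phi) w)}.
  apply: filterS2 (solution_equation hX dphi tT) (solution_equation hX dphi sT) => w.
  by rewrite /coord => -> ->; ring.
have ae_be : {ae P, forall w,
    W t (adjoint ip (total_op S) phi) w - W s (adjoint ip (total_op S) phi) w =
    (be t \- be s) w}.
  by apply: filterS2 (version_ae hbe tT) (version_ae hbe sT) => w -> ->.
apply: filterS3 aeg ae_x ae_be => w i0 ex ew.
have sub : `[s, t] `<=` `[0, t].
  by move=> u /=; rewrite !in_itv/= => /andP[su ut]; lra.
have ist : mu.-integrable `[s, t] (EFin \o (a ^~ w)).
  by apply: integrableS i0 => //; exact: measurable_itv.
split => //.
have soc : `]s, t] `<=` `[s, t].
  by move=> u /=; rewrite !in_itv/= => /andP[/ltW-> ->].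
(* The difference of the integrals over [[0, t]] and [[0, s]] is an integral over []s, t]]; the end
   point [s] is negligible. *)
rewrite -Rintegral_itv_obnd_cbnd; last first.
  by apply: integrableS ist => //; exact: measurable_itv.
rewrite -(@Rintegral_itvB _ _ (BLeft 0)) ?bnd_simp ?(ltW st)//.
by rewrite /= ex ew addrK.
Qed.

(** Used twice: [c = 0], with [e] the moment bound on the drift, gives continuity of the coordinate;
    [c = 1], with [e] small by continuity of the drift, gives the first-order expansion. *)
Lemma increment_norm2 s t : s \in `[0, T] -> t \in `[0, T] -> s < t ->
  forall tau c e, tau \in `[0, T] -> 0 <= e ->
  (forall u, u \in `[s, t] -> norm2 (fun w => a u w - c * a tau w) <= e) ->
  norm2 (coord phi t \- coord phi s \- (fun w => (t - s) * (c * a tau w))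
         \- (be t \- be s)) <= e * (t - s).
Proof.
move=> sT tT st tau c e tauT e0 he; have [s0 t1] := bounds sT tT.
have sat u : u \in `[s, t] -> sqint (fun w => a u w - c * a tau w).
  move=> ut; apply: (sqintB measurableT); first exact: coord_sqint (sub_itv sT tT ut).
  by apply: sqintZ => //; exact: coord_sqint.
have mg : measurable_fun ((`[s, t] : set (measurableTypeR R)) `*` setT)
    (fun p : measurableTypeR R * Omega => a p.1 p.2 - c * a tau p.2).
  apply: measurable_funB; first exact: coord_joint.
  apply: measurable_funM => //.
  apply: (measurableT_comp (coord_measurable _ tauT)).
  by apply: measurable_funTS; exact: measurable_snd.
apply: (@time_integral_norm2 _ _ _ P s t st (fun u w => a u w - c * a tau w) mg e e0 _ _ _ _).2.
- move=> u ut; rewrite (integral_sqr measurableT (sat u ut)) lee_fin.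
  by rewrite ler_sqr ?nnegrE ?norm2_ge0// he.
- have := version_sqint hbe sT tT st => -[mb _].
  apply: measurable_funB => //; apply: measurable_funB; first apply: measurable_funB.
  + exact: coord_measurable.
  + exact: coord_measurable.
  + by do 2 apply: measurable_funM => //; exact: coord_measurable.
- apply: filterS (increment_ae sT tT st) => w [ia incr].
  rewrite RintegralB//; last first.
    apply: continuous_compact_integrable; first exact: segment_compact.
    by apply: continuous_subspaceT => ?; exact: cvg_cst.
  rewrite -incr Rintegral_cst//= lebesgue_measure_itv/= lte_fin st /=.
  by ring.
Qed.

Lemma coord_dom_continuous tau e : tau \in `[0, T] -> 0 < e ->
  exists2 r, 0 < r & forall u, u \in `[0, T] -> `|u - tau| < r ->
    norm2 (coord phi u \- coord phi tau) <= e.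
Proof.
move=> tauT e0; have [N N0 NP] := second_moment.
pose K := N * `|adjoint ip A phi|.
have K0 : 0 <= K by rewrite mulr_ge0.
have e2 : 0 < e / 2 by rewrite divr_gt0.
have [r1 r10 r1P] := noise_small (version_sqr hbe) e2.
have main s t : s \in `[0, T] -> t \in `[0, T] -> s < t -> t - s < r1 ->
    t - s < e / 2 / (K + 1) -> norm2 (coord phi t \- coord phi s) <= e.
  move=> sT tT st h1 h2.
  have sb := version_sqint hbe sT tT st.
  have sx := sqintB measurableT (coord_sqint phi tT) (coord_sqint phi sT).
  have := increment_norm2 sT tT st (c := 0) tauT K0.
  have -> : coord phi t \- coord phi s \- (fun w => (t - s) * (0 * a tau w))
      \- (be t \- be s) = coord phi t \- coord phi s \- (be t \- be s).
    by apply/funext => w /=; ring.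
  have hK u : u \in `[s, t] -> norm2 (fun w => a u w - 0 * a tau w) <= K.
    move=> ut; have uT := sub_itv sT tT ut.
    rewrite (_ : (fun w => _) = a u); last by apply/funext => w; ring.
    by apply: norm2_le => //; exact: NP.
  move=> /(_ hK) hD.
  have sD := sqintB measurableT sx sb.
  have -> : coord phi t \- coord phi s =
      (coord phi t \- coord phi s \- (be t \- be s)) \+ (be t \- be s).
    by apply/funext => w /=; ring.
  rewrite (le_trans (norm2D _ sD sb))//.
  have := r1P s t sT tT st h1.
  have d0 : 0 < t - s by rewrite subr_gt0.
  move: h2; rewrite ltr_pdivlMr ?ltr_wpDl// => h2 h3.
  have : K * (t - s) <= e / 2 by rewrite mulrDr mulr1 in h2; lra.
  by move=> h4; lra.
exists (Num.min r1 (e / 2 / (K + 1))).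
  by rewrite lt_min r10 divr_gt0// ltr_wpDl.
move=> u uT; rewrite lt_min => /andP[u1 u2].
have [lt|gt|->] := ltgtP u tau.
- rewrite norm2_distC; apply: main => //.
    by rewrite ltr0_norm ?subr_lt0// opprB in u1.
  by rewrite ltr0_norm ?subr_lt0// opprB in u2.
- apply: main => //.
    by rewrite gtr0_norm ?subr_gt0// in u1.
  by rewrite gtr0_norm ?subr_gt0// in u2.
- rewrite (_ : _ \- _ = (fun w => 0 * coord phi tau w)).
    by rewrite norm2Z ?normr0 ?mul0r ?(ltW e0)//; exact: coord_sqint.
  by apply/funext => w /=; ring.
Qed.

End Increments.

(** Applied later to [eta = A^* phi], for which the weak equation need not be available; hence the
    approximation by some [phi] in the domain of [A^*]. *)
Lemma coord_continuous eta tau e : tau \in `[0, T] -> 0 < e ->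
  exists2 r, 0 < r & forall u, u \in `[0, T] -> `|u - tau| < r ->
    norm2 (coord eta u \- coord eta tau) <= e.
Proof.
move=> tauT e0; have [N N0 NP] := second_moment.
have e3 : 0 < e / 3 by rewrite divr_gt0.
(* The tolerance [e / 3 / (N + 1)] makes the coordinate along [eta - phi] at most [e / 3] in norm at
   every time. *)
have [phi dphi ephi] := dense_dom eta (divr_gt0 e3 (ltr_wpDl N0 ltr01)).
have [be hbe] := wiener_version_exists hF hW (adjoint ip (total_op S) phi).
have [r r0 rP] := coord_dom_continuous dphi hbe tauT e3.
exists r => // u uT ur.
have sm : norm2 (coord (eta - phi) u) <= e / 3 /\
    norm2 (coord (eta - phi) tau) <= e / 3.
  suff h v : v \in `[0, T] -> norm2 (coord (eta - phi) v) <= e / 3 by split; exact: h.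
  move=> vT; rewrite (le_trans (norm2_le _ (NP _ _ vT)))// ?mulr_ge0//.
  move: ephi; rewrite ltr_pdivlMr ?ltr_wpDl// => /ltW; apply: le_trans.
  by rewrite mulrC ler_wpM2l// lerDl.
have [s1 s2] := sm.
have su := coord_sqint (eta - phi) uT; have stau := coord_sqint (eta - phi) tauT.
have sphi := sqintB measurableT (coord_sqint phi uT) (coord_sqint phi tauT).
have sd := sqintB measurableT su stau.
have -> : coord eta u \- coord eta tau = (coord phi u \- coord phi tau) \+
    (coord (eta - phi) u \- coord (eta - phi) tau).
  by apply/funext => w /=; rewrite /coord !ipBr; ring.
rewrite (le_trans (norm2D _ sphi sd))//.
have -> : coord (eta - phi) u \- coord (eta - phi) tau =
    coord (eta - phi) u \+ (fun w => -1 * coord (eta - phi) tau w).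
  by apply/funext => w /=; ring.
have := norm2D measurableT su (sqintZ measurableT (-1) stau).
rewrite norm2Z// normrN1 mul1r.
have := rP u uT ur.
by move=> h1 h2; lra.
Qed.

Lemma coord_drift_noise phi be : dom (adjoint ip A) phi ->
  wiener_version P T F W (adjoint ip (total_op S) phi) be ->
  drift_noise P T (coord phi) (coord (adjoint ip A phi)) be.
Proof.
move=> dphi hbe; split.
- by move=> t; exact: coord_sqint.
- by move=> t; exact: coord_sqint.
- exact: version_sqint hbe.
- move=> tau tauT e e0.
  have [r r0 rP] := coord_continuous (adjoint ip A phi) tauT e0.
  exists r => // s t sT tT st sr tr.
  have := increment_norm2 dphi hbe sT tT st (c := 1) tauT (ltW e0).
  have -> : (fun w => (t - s) * (1 * coord (adjoint ip A phi) tau w)) =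
      (fun w => (t - s) * coord (adjoint ip A phi) tau w).
    by apply/funext => w; rewrite mul1r.
  apply => u; rewrite in_itv/= => /andP[su ut].
  rewrite (_ : (fun w => _) =
    coord (adjoint ip A phi) u \- coord (adjoint ip A phi) tau); last first.
    by apply/funext => w /=; rewrite mul1r.
  apply: rP.
    by move: sT tT; rewrite !in_itv/= => /andP[? ?] /andP[? ?]; lra.
  by move: sr tr; rewrite !ltr_norml => /andP[? ?] /andP[? ?]; lra.
Qed.

Lemma constant_drift_noise : drift_noise P T (fun _ _ => 1) (fun _ _ => 0) (fun _ _ => 0).
Proof.
have s0 := sqint_cst measurableT 0 Py.
have e0 (r : R) : (fun=> 0) \- (fun=> 0) = (fun=> r * 0) :> (Omega -> R).
  by apply/funext => w /=; rewrite subrr mulr0.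
split => //.
- by move=> t _; exact: sqint_cst.
- by move=> s t _ _ _; rewrite (e0 0); exact: sqintZ.
- move=> tau tauT e e_gt0; exists 1 => // s t sT tT st _ _.
  rewrite (_ : _ \- _ = (fun w => 0 * 0)); last by apply/funext => w /=; ring.
  rewrite norm2Z// normr0 mul0r mulr_ge0 ?(ltW e_gt0)//.
  by rewrite subr_ge0 ltW.
Qed.

Lemma mean_derivative phi tau : dom (adjoint ip A) phi -> tau \in `[0, T] ->
  has_derivative_within `[0, T] (fun t => dotp (coord phi t) (fun=> 1)) tau
    (dotp (coord (adjoint ip A phi) tau) (fun=> 1)).
Proof.
move=> dphi tauT.
have [be hbe] := wiener_version_exists hF hW (adjoint ip (total_op S) phi).
have s0 := sqint_cst measurableT 0 Py; have s1 := sqint_cst measurableT 1 Py.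
have e0 : (fun=> 0) \- (fun=> 0) = (fun=> 0 * 0) :> (Omega -> R).
  by apply/funext => w /=; rewrite subrr mulr0.
have := product_rule (cg := 0) (q := 0) tauT (coord_drift_noise dphi hbe)
  constant_drift_noise.
have sa := coord_sqint (adjoint ip A phi) tauT; have sx := coord_sqint phi tauT.
have -> : dotp (coord phi tau) (fun=> 0) = 0.
  rewrite (_ : (fun=> 0) = (fun w => 0 * (fun=> 0) w) :> (Omega -> R)).
    by rewrite dotpZr// mul0r.
  by apply/funext => w; rewrite mul0r.
rewrite add0r addr0; apply => s t sT tT st.
have sb := version_sqint hbe sT tT st; have sxs := coord_sqint phi sT.
split; first exact: version_sqr hbe _ _ sT tT st.
- by rewrite mulr0 e0 dotpZl ?mul0r//; exact: sqintZ.
- by rewrite mulr0 e0 dotpZr ?mul0r.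
- by rewrite e0 dotpZr ?mul0r.
- rewrite dotpC; apply: (version_orthogonal hbe) => // B mB.
  have [F0 FC _] := filtration_sigma hF sT.
  (* The constant 1 belongs to the past: its preimages are the whole space or empty. Orthogonality
     to it says that the noise increment has mean 0. *)
  have [B1|B1] := pselect (B 1).
    rewrite (_ : _ @^-1` B = setT `\` set0); first exact: FC.
    by rewrite setD0; apply/seteqP; split.
  by rewrite (_ : _ @^-1` B = set0)//; apply/seteqP; split.
Qed.

Lemma covariance_derivative phi psi tau :
  dom (adjoint ip A) phi -> dom (adjoint ip A) psi -> tau \in `[0, T] ->
  has_derivative_within `[0, T] (fun t => dotp (coord phi t) (coord psi t)) tau
    (dotp (coord phi tau) (coord (adjoint ip A psi) tau) +
     dotp (coord (adjoint ip A phi) tau) (coord psi tau) +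
     ip (adjoint ip (total_op S) phi) (adjoint ip (total_op S) psi)).
Proof.
move=> dphi dpsi tauT.
have [be hbe] := wiener_version_exists hF hW (adjoint ip (total_op S) phi).
have [ga hga] := wiener_version_exists hF hW (adjoint ip (total_op S) psi).
apply: (product_rule tauT (coord_drift_noise dphi hbe) (coord_drift_noise dpsi hga)).
move=> s t sT tT st; split.
- exact: version_sqr hbe _ _ sT tT st.
- exact: version_sqr hga _ _ sT tT st.
- exact: (wiener_version_covariance hip hF hW hbe hga).
- apply: (version_orthogonal hga sT tT st (coord_sqint phi sT)).
  exact: coord_adapted.
- rewrite dotpC; apply: (version_orthogonal hbe sT tT st (coord_sqint psi sT)).
  exact: coord_adapted.
Qed.

End WeakSolution.

(** The identification of [m] and [C] with expectations holds on [[0, T]] only, so functions must be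
    exchanged within [D]. *)
Lemma has_derivative_within_eq (R : realType) (D : set R) (f g : R -> R) (t l : R) :
  D t -> (forall s, D s -> f s = g s) ->
  has_derivative_within D g t l -> has_derivative_within D f t l.
Proof.
move=> Dt fg; apply: cvg_trans; apply: near_eq_cvg.
by rewrite near_withinE; apply: nearW => s Ds; rewrite !fg.
Qed.

(** [adjoint] picks its value by [xget] with default 0; for bounded [S], Riesz shows that a genuine
    adjoint vector exists, so the picked value is one. *)
Lemma adjoint_boundedP (R : realType) (H : completeNormedModType R)
    (ip : {dot H for idfun}) (S : {linear H -> H}) :
  induces_norm ip -> continuous S ->
  forall x phi, ip (S x) phi = ip x (adjoint ip (total_op S) phi).
Proof.
move=> hip cS x phi.
have lS : linear S by move=> a u v; rewrite linearP.
have [K K0 KP] := linear_continuous_bound lS cS.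
have [eta etaP] : exists eta, forall x, ip (S x) phi = ip x eta.
  apply: (@riesz _ _ ip hip (fun x => ip (S x) phi) (K * `|phi|)).
    by move=> a u v; rewrite lS ipDl ipZl.
  move=> u; rewrite (le_trans (ip_le_norm hip _ _))// mulrAC.
  by rewrite ler_wpM2r.
have := @xgetPex _ 0 [set eta | adjoint_pair ip (total_op S) phi eta].
by move=> h; apply: h => //; exists eta => y _; exact: etaP.
Qed.

Theorem theorem1 (R : realType) (H : completeNormedModType R)
    (ip : {dot H for idfun}) (hip : induces_norm ip) (hsep : separable H)
    (U : R -> H -> H) (A : operator H) (hU : C0_semigroup U)
    (hA : is_generator U A)
    (S : {linear H -> H}) (hS : continuous S)
    (d : measure_display) (Omega : measurableType d) (P : probability Omega R)
    (T : R) (hT : 0 < T)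
    (F : R -> set (set Omega)) (hF : filtration T F)
    (W : R -> H -> Omega -> R) (hW : cylindrical_wiener P T F W)
    (X : R -> Omega -> H) (hX : weak_solution ip P T F W A S X)
    (m : R -> H) (hm : is_mean ip P T X m)
    (C : R -> H -> H) (hC : is_covariance ip P T X C) :
  let Aadj := adjoint ip A in
  let Sadj := adjoint ip (total_op S) in
  (forall phi, dom Aadj phi -> forall t, t \in `[0, T] ->
     has_derivative_within `[0, T] (fun s => ip (m s) phi) t
       (ip (m t) (Aadj phi))) /\
  (forall phi psi, dom Aadj phi -> dom Aadj psi -> forall t, t \in `[0, T] ->
     has_derivative_within `[0, T] (fun s => ip (C s phi) psi) t
       (ip (C t phi) (Aadj psi) + ip (C t (Aadj phi)) psi
        + ip (S (Sadj phi)) psi)).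
Proof.
have dense := dense_dom_adjoint hip hU hA.
have SadjP := adjoint_boundedP hip hS.
have P1 : (P setT < +oo)%E by rewrite probability_setT ltry.
have meanE phi t : t \in `[0, T] ->
    ip (m t) phi = dotp P setT (coord ip X phi t) (fun=> 1).
  move=> tT; apply: EFin_inj; rewrite (hm t tT phi) unlock /dotp /Rintegral fineK.
    by apply: eq_integral => w _; rewrite mulr1.
  apply: integrable_fin_num => //; apply: sqintM => //; last exact: sqint_cst.
  exact: (coord_sqint hip hF hX).
have covE phi psi t : t \in `[0, T] ->
    ip (C t phi) psi = dotp P setT (coord ip X phi t) (coord ip X psi t).
  move=> tT; apply: EFin_inj; rewrite (hC t tT phi psi) unlock /dotp /Rintegral fineK//.
  by apply: integrable_fin_num => //; apply: sqintM => //; exact: (coord_sqint hip hF hX).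
move=> Aadj Sadj; split.
- move=> phi dphi t tT; rewrite meanE//.
  apply: has_derivative_within_eq (mean_derivative hip hF hW hX dense dphi tT) => //.
  by move=> s; exact: meanE.
(* [SadjP] moves [S] across the pairing, giving the noise covariance of [S^* phi] and [S^* psi]. *)
- move=> phi psi dphi dpsi t tT; rewrite !covE// SadjP.
  apply: has_derivative_within_eq
    (covariance_derivative hip hF hW hX dense dphi dpsi tT) => //.
  by move=> s; exact: covE.
Qed.
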